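(* Let $K$ be a field and let $n$ be a positive integer. Then $$K_0(L_K(C_n^2))\cong \mathbb{Z}_{d(n)}\times\mathbb{Z}_{\frac{H_2(n)}{d(n)}}.$$ Furthermore, $K_0(L_K(C_n^2))$ is cyclic if and only if $n=2$, $n=4$, $n\equiv 1\ \mathrm{mod}\ 6$, or $n\equiv 5\ \mathrm{mod}\ 6$.
   Context: For a directed graph $E=(E^0,E^1,r,s)$ and a field $K$, the Leavitt path algebra $L_K(E)$ is the $K$-algebra generated by $\{v\mid v\in E^0\}\cup\{e,e^*\mid e\in E^1\}$ subject to: (V) $vw=\delta_{v,w}v$ for $v,w\in E^0$; (E1) $s(e)e=er(e)=e$; (E2) $r(e)e^*=e^*s(e)=e^*$; (CK1) $e^*e'=\delta_{e,e'}r(e)$ for $e,e'\in E^1$; (CK2) $v=\sum_{\{e\in E^1\mid s(e)=v\}}ee^*$ for every $v\in E^0$ with $0<|s^{-1}(v)|<\infty$. $K_0$ denotes the Grothendieck group of a ring. $C_n^2$ is the directed graph with $n$ vertices $v_1,\dots,v_n$ and $2n$ edges $e_1,\dots,e_n,f_1,\dots,f_n$, where $e_i$ goes from $v_i$ to $v_{i+1}$ and $f_i$ goes from $v_i$ to $v_{i+2}$ (subscripts mod $n$). Its incidence matrix $A_{C_n^2}$ is the $n\times n$ matrix whose $(i,k)$ entry is the number of edges from $v_i$ to $v_k$, and $H_2(n)=|\det(I_n-A_{C_n^2}^t)|$ (the second Haselgrove sequence $1,1,4,5,11,16,29,45,\dots$; equivalently $H_2(1)=H_2(2)=1$ and $H_2(n)=H_2(n-1)+H_2(n-2)+1-(-1)^n$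 for $n\geq 3$). $F$ is the Fibonacci sequence: $F(0)=0$, $F(1)=F(2)=1$, $F(n)=F(n-1)+F(n-2)$. For $n\geq 1$, $d(n)=\gcd(F(n),F(n-1)-1)$; $H_2(n)/d(n)$ is an integer. $\mathbb{Z}_k$ is the cyclic group of order $k$, with $\mathbb{Z}_1=\{0\}$. *)

(* Defs.v *)
From HB Require Import structures.
From mathcomp Require Import all_boot all_order all_algebra generic_quotient.
From mathcomp Require Import boolp.

Set Implicit Arguments.
Unset Strict Implicit.
Unset Printing Implicit Defensive.

Import GRing.Theory.
Local Open Scope ring_scope.
Local Open Scope quotient_scope.

(* Algebras are not assumed to be unital here: terms have no constant 1. *)
Inductive term (K X : Type) : Type :=
  | Gen of X
  | Zero
  | Add of term K X & term K X
  | Scale of K & term K X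
  | Mul of term K X & term K X.
Arguments Gen {K X}.
Arguments Zero {K X}.

HB.instance Definition _ (K X : Type) := gen_eqMixin (term K X).
HB.instance Definition _ (K X : Type) := gen_choiceMixin (term K X).

Section Presentation.
Variables (K : fieldType) (X : Type) (rel : term K X -> term K X -> Prop).

(* The least congruence containing rel whose quotient is an associative
   K-algebra. *)
Inductive cong : term K X -> term K X -> Prop :=
  | cong_rel s t : rel s t -> cong s t
  | cong_refl t : cong t t
  | cong_sym s t : cong s t -> cong t s
  | cong_trans s t u : cong s t -> cong t u -> cong s u
  | cong_Add s s' t t' : cong s s' -> cong t t' -> cong (Add s t) (Add s' t')
  | cong_Scale a t t' : cong t t' -> cong (Scale a t) (Scale a t')
  | cong_Mul s s' t t' : cong s s' -> cong t t' -> cong (Mul s t) (Mul s' t')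
  | cong_addA s t u : cong (Add s (Add t u)) (Add (Add s t) u)
  | cong_addC s t : cong (Add s t) (Add t s)
  | cong_add0 t : cong (Add Zero t) t
  | cong_addN t : cong (Add (Scale (-1) t) t) Zero
  | cong_scaleA a b t : cong (Scale a (Scale b t)) (Scale (a * b) t)
  | cong_scale1 t : cong (Scale 1 t) t
  | cong_scaleDr a s t : cong (Scale a (Add s t)) (Add (Scale a s) (Scale a t))
  | cong_scaleDl a b t : cong (Scale (a + b) t) (Add (Scale a t) (Scale b t))
  | cong_mulA s t u : cong (Mul s (Mul t u)) (Mul (Mul s t) u)
  | cong_mulDl s t u : cong (Mul (Add s t) u) (Add (Mul s u) (Mul t u))
  | cong_mulDr s t u : cong (Mul s (Add t u)) (Add (Mul s t) (Mul s u))
  | cong_scaleAl a s t : cong (Scale a (Mul s t)) (Mul (Scale a s) t)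
  | cong_scaleAr a s t : cong (Scale a (Mul s t)) (Mul s (Scale a t)).

Definition congb (s t : term K X) : bool := `[< cong s t >].

Lemma congb_refl : reflexive congb.
Proof. by move=> t; apply/asboolP/cong_refl. Qed.
Lemma congb_sym : symmetric congb.
Proof. by move=> s t; apply/asboolP/asboolP => /cong_sym. Qed.
Lemma congb_trans : transitive congb.
Proof. by move=> t s u /asboolP st /asboolP tu; apply/asboolP/(cong_trans st). Qed.

Canonical cong_equiv := EquivRel congb congb_refl congb_sym congb_trans.

Definition presented := {eq_quot cong_equiv}.
HB.instance Definition _ := Choice.on presented.
HB.instance Definition _ := EqQuotient.on presented.

Local Notation cl := (\pi_presented).

Lemma presented_eqP s t : cl s = cl t <-> cong s t.
Proof. by split=> [/eqmodP/asboolP // | st]; apply/eqmodP/asboolP. Qed.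

Lemma cong_repr t : cong (repr (cl t)) t.
Proof. by apply/presented_eqP; rewrite reprK. Qed.

Definition padd (x y : presented) : presented := cl (Add (repr x) (repr y)).
Definition pmul (x y : presented) : presented := cl (Mul (repr x) (repr y)).
Definition pscale (a : K) (x : presented) : presented := cl (Scale a (repr x)).

Lemma paddE s t : padd (cl s) (cl t) = cl (Add s t).
Proof. by apply/presented_eqP/cong_Add; apply: cong_repr. Qed.
Lemma pmulE s t : pmul (cl s) (cl t) = cl (Mul s t).
Proof. by apply/presented_eqP/cong_Mul; apply: cong_repr. Qed.
Lemma pscaleE a t : pscale a (cl t) = cl (Scale a t).
Proof. by apply/presented_eqP/cong_Scale/cong_repr. Qed.

Lemma paddA : associative padd.
Proof.
elim/quotW=> s; elim/quotW=> t; elim/quotW=> u.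
by rewrite (paddE s t) (paddE t u) !paddE; apply/presented_eqP/cong_addA.
Qed.
Lemma paddC : commutative padd.
Proof.
elim/quotW=> s; elim/quotW=> t.
by rewrite !paddE; apply/presented_eqP/cong_addC.
Qed.
Lemma padd0 : left_id (cl Zero) padd.
Proof. by elim/quotW=> t; rewrite paddE; apply/presented_eqP/cong_add0. Qed.
Lemma paddN : left_inverse (cl Zero) (pscale (-1)) padd.
Proof. by elim/quotW=> t; rewrite pscaleE paddE; apply/presented_eqP/cong_addN. Qed.

HB.instance Definition _ := GRing.isZmodule.Build presented paddA paddC padd0 paddN.

Lemma pscaleA a b x : pscale a (pscale b x) = pscale (a * b) x.
Proof.
elim/quotW: x => t; rewrite (pscaleE b t) !pscaleE.
exact/presented_eqP/cong_scaleA.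
Qed.
Lemma pscale1 : left_id 1 pscale.
Proof. by elim/quotW=> t; rewrite pscaleE; apply/presented_eqP/cong_scale1. Qed.
Lemma pscaleDr : right_distributive pscale +%R.
Proof.
move=> a; elim/quotW=> s; elim/quotW=> t.
rewrite [cl s + cl t]paddE (pscaleE a s) (pscaleE a t) pscaleE [RHS]paddE.
exact/presented_eqP/cong_scaleDr.
Qed.
Lemma pscaleDl x : {morph pscale^~ x : a b / a + b}.
Proof.
move=> a b; elim/quotW: x => t; rewrite !pscaleE [RHS]paddE.
exact/presented_eqP/cong_scaleDl.
Qed.

HB.instance Definition _ :=
  GRing.Zmodule_isLmodule.Build K presented pscaleA pscale1 pscaleDr pscaleDl.

Lemma pmulA : associative pmul.
Proof.
elim/quotW=> s; elim/quotW=> t; elim/quotW=> u.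
by rewrite (pmulE s t) (pmulE t u) !pmulE; apply/presented_eqP/cong_mulA.
Qed.
Lemma pmulDl : left_distributive pmul +%R.
Proof.
elim/quotW=> s; elim/quotW=> t; elim/quotW=> u.
rewrite [cl s + cl t]paddE (pmulE s u) (pmulE t u) pmulE [RHS]paddE.
by apply/presented_eqP/cong_mulDl.
Qed.
Lemma pmulDr : right_distributive pmul +%R.
Proof.
elim/quotW=> s; elim/quotW=> t; elim/quotW=> u.
rewrite [cl t + cl u]paddE (pmulE s t) (pmulE s u) pmulE [RHS]paddE.
by apply/presented_eqP/cong_mulDr.
Qed.
Lemma pscaleAl a x y : a *: pmul x y = pmul (a *: x) y.
Proof.
elim/quotW: x => s; elim/quotW: y => t.
rewrite [a *: cl s]pscaleE !pmulE [LHS]pscaleE.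
exact/presented_eqP/cong_scaleAl.
Qed.
Lemma pscaleAr a x y : a *: pmul x y = pmul x (a *: y).
Proof.
elim/quotW: x => s; elim/quotW: y => t.
rewrite [a *: cl t]pscaleE !pmulE [LHS]pscaleE.
exact/presented_eqP/cong_scaleAr.
Qed.

Lemma pmul0l x : pmul 0 x = 0.
Proof. by apply: (addrI (pmul 0 x)); rewrite -pmulDl !addr0. Qed.
Lemma pmul0r x : pmul x 0 = 0.
Proof. by apply: (addrI (pmul x 0)); rewrite -pmulDr !addr0. Qed.

Lemma pmul_suml (I : finType) (F : I -> presented) x :
  pmul (\sum_i F i) x = \sum_i pmul (F i) x.
Proof.
by apply: (big_morph (pmul^~ x)) => [u v|]; [apply: pmulDl | apply: pmul0l].
Qed.
Lemma pmul_sumr (I : finType) (F : I -> presented) x :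
  pmul x (\sum_i F i) = \sum_i pmul x (F i).
Proof.
by apply: (big_morph (pmul x)) => [u v|]; [apply: pmulDr | apply: pmul0r].
Qed.

Lemma presented_ind (P : presented -> Prop) :
    (forall x, P (cl (Gen x))) -> P 0 ->
    (forall x y, P x -> P y -> P (x + y)) ->
    (forall a x, P x -> P (a *: x)) ->
    (forall x y, P x -> P y -> P (pmul x y)) ->
  forall x, P x.
Proof.
move=> Pg P0 PD PZ PM; elim/quotW; elim=> [|//|s Ps t Pt|a t Pt|s Ps t Pt].
- exact: Pg.
- by rewrite -paddE; apply: PD.
- by rewrite -pscaleE; apply: PZ.
- by rewrite -pmulE; apply: PM.
Qed.

End Presentation.

(* Finite graphs only; finiteness of the set of vertices is what makes the
   Leavitt path algebra unital. *)
Record digraph := Digraph {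
  vertex : finType;
  edge : finType;
  src : edge -> vertex;
  tgt : edge -> vertex }.

Section Leavitt.
Variables (K : fieldType) (E : digraph).

Inductive leavitt_gen :=
  | Vertex of vertex E
  | Edge of edge E
  | Ghost of edge E.

Local Notation V v := (Gen (Vertex v)).
Local Notation e_ e := (Gen (Edge e)).
Local Notation g_ e := (Gen (Ghost e)).

Inductive leavitt_rel : term K leavitt_gen -> term K leavitt_gen -> Prop :=
  | rel_V v w : leavitt_rel (Mul (V v) (V w)) (if v == w then V v else Zero)
  | rel_E1s e : leavitt_rel (Mul (V (src e)) (e_ e)) (e_ e)
  | rel_E1r e : leavitt_rel (Mul (e_ e) (V (tgt e))) (e_ e)
  | rel_E2r e : leavitt_rel (Mul (V (tgt e)) (g_ e)) (g_ e)
  | rel_E2s e : leavitt_rel (Mul (g_ e) (V (src e))) (g_ e)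
  | rel_CK1 e f :
      leavitt_rel (Mul (g_ e) (e_ f)) (if e == f then V (tgt e) else Zero)
  | rel_CK2 v : (0 < #|[set e | @src E e == v]|)%N ->
      leavitt_rel (V v)
        (\big[@Add _ _/Zero]_(e | @src E e == v) Mul (e_ e) (g_ e)).

Definition leavitt := presented leavitt_rel.
HB.instance Definition _ := GRing.Lmodule.on leavitt.

Definition lgen (x : leavitt_gen) : leavitt := \pi_leavitt (Gen x).
Definition lone : leavitt := \sum_v lgen (Vertex v).

Local Notation "x ** y" := (@pmul _ _ leavitt_rel x y) (at level 40).

Lemma lgen_V v w :
  lgen (Vertex v) ** lgen (Vertex w) = if v == w then lgen (Vertex v) else 0.
Proof.
rewrite pmulE (proj2 (presented_eqP _ _ _) (cong_rel (rel_V v w))).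
by case: ifP.
Qed.

Lemma lone_V v : lone ** lgen (Vertex v) = lgen (Vertex v).
Proof.
rewrite pmul_suml (bigD1 v) //= lgen_V eqxx big1 ?addr0 // => w /negPf wv.
by rewrite lgen_V wv.
Qed.
Lemma V_lone v : lgen (Vertex v) ** lone = lgen (Vertex v).
Proof.
rewrite pmul_sumr (bigD1 v) //= lgen_V eqxx big1 ?addr0 // => w.
by rewrite lgen_V eq_sym => /negPf ->.
Qed.

Lemma lone_gen x : lone ** lgen x = lgen x.
Proof.
have relE s t (st : leavitt_rel s t) : \pi_leavitt t = \pi_leavitt s.
  exact/esym/presented_eqP/cong_rel.
case: x => [v|e|e]; first exact: lone_V.
- by rewrite /lgen (relE _ _ (rel_E1s e)) -pmulE pmulA lone_V.
- by rewrite /lgen (relE _ _ (rel_E2r e)) -pmulE pmulA lone_V.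
Qed.
Lemma gen_lone x : lgen x ** lone = lgen x.
Proof.
have relE s t (st : leavitt_rel s t) : \pi_leavitt t = \pi_leavitt s.
  exact/esym/presented_eqP/cong_rel.
case: x => [v|e|e]; first exact: V_lone.
- by rewrite /lgen (relE _ _ (rel_E1r e)) -pmulE -pmulA V_lone.
- by rewrite /lgen (relE _ _ (rel_E2s e)) -pmulE -pmulA V_lone.
Qed.

Lemma lmul1l : left_id lone (@pmul _ _ leavitt_rel).
Proof.
elim/presented_ind=> [x||x y xP yP|a x xP|x y xP yP].
- exact: lone_gen.
- exact: pmul0r.
- by rewrite pmulDr xP yP.
- by rewrite -pscaleAr xP.
- by rewrite pmulA xP.
Qed.
Lemma lmul1r : right_id lone (@pmul _ _ leavitt_rel).
Proof.
elim/presented_ind=> [x||x y xP yP|a x xP|x y xP yP].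
- exact: gen_lone.
- exact: pmul0l.
- by rewrite pmulDl xP yP.
- by rewrite -pscaleAl xP.
- by rewrite -pmulA yP.
Qed.

(* A pzRingType, as this does not require 1 != 0; the K-algebra structure is
   given by the lmodType instance together with pscaleAl and pscaleAr. *)
HB.instance Definition _ := GRing.Zmodule_isPzRing.Build leavitt
  (@pmulA _ _ leavitt_rel) lmul1l lmul1r
  (@pmulDl _ _ leavitt_rel) (@pmulDr _ _ leavitt_rel).

End Leavitt.

Definition lmod_iso (R : pzRingType) (M N : lmodType R) : Prop :=
  exists f : {linear M -> N}, bijective f.

Section FgProj.
Variable R : pzRingType.

Lemma lmod_iso_refl (M : lmodType R) : lmod_iso M M.
Proof. by exists (@idfun M); exists id. Qed.

Lemma lmod_iso_sym (M N : lmodType R) : lmod_iso M N -> lmod_iso N M.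
Proof.
move=> [f [g fK gK]].
pose gL := GRing.isLinear.Build R N M *:%R g (can2_linear fK gK).
by exists (HB.pack_for {linear N -> M} g gL); exists f.
Qed.

Lemma lmod_iso_trans (M N P : lmodType R) :
  lmod_iso M N -> lmod_iso N P -> lmod_iso M P.
Proof. by move=> [f bf] [g bg]; exists (g \o f); apply: bij_comp. Qed.

(* A finitely generated projective left R-module is, up to isomorphism, the
   image R^n e of an idempotent matrix e acting on row vectors (see fgproj_im
   and im_fgproj below); these images are taken as representatives because the
   class of all such modules is not a small type. *)
Record idem := Idem {
  idim : nat;
  imx :> 'M[R]_idim;
  imx_idem : imx *m imx = imx }.

Section Image.
Variable e : idem.

Definition im_pred : {pred 'rV[R]_(idim e)} := [pred v | v *m e == v].

Lemma im_pred_submod : submod_closed im_pred.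
Proof.
split=> [|a u v]; rewrite !inE ?mul0mx // => /eqP ue /eqP ve.
by rewrite mulmxDl -scalemxAl ue ve.
Qed.
HB.instance Definition _ :=
  GRing.isSubmodClosed.Build R 'rV[R]_(idim e) im_pred im_pred_submod.

Record im := Im { imval :> 'rV[R]_(idim e); _ : imval \in im_pred }.
HB.instance Definition _ := [isSub for imval].
HB.instance Definition _ := [Choice of im by <:].
HB.instance Definition _ := [SubChoice_isSubLmodule of im by <:].

Lemma im_fix (v : im) : val v *m e = val v.
Proof. exact/eqP/(valP v). Qed.

Fact imp_subproof (v : 'rV[R]_(idim e)) : v *m e \in im_pred.
Proof. by rewrite inE -mulmxA imx_idem. Qed.
Definition imp (v : 'rV[R]_(idim e)) : im := Im (imp_subproof v).

Fact imp_is_linear : linear imp.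
Proof. by move=> a u v; apply: val_inj; rewrite /= mulmxDl -scalemxAl. Qed.
HB.instance Definition _ := GRing.isLinear.Build R _ _ _ imp imp_is_linear.

Lemma impK (v : im) : imp (val v) = v.
Proof. by apply: val_inj; rewrite /= im_fix. Qed.

End Image.
Arguments imp : clear implicits.
Arguments im_pred : clear implicits.

Definition finitely_generated (M : lmodType R) : Prop :=
  exists n (p : {linear 'rV[R]_n -> M}), forall y, exists x, p x = y.

Definition projective (M : lmodType R) : Prop :=
  forall (N P : lmodType R) (g : {linear N -> P}) (h : {linear M -> P}),
    (forall y, exists x, g x = y) -> exists k : {linear M -> N}, g \o k =1 h.

Lemma im_fgproj (e : idem) : finitely_generated (im e) /\ projective (im e).
Proof.
split.
  exists (idim e), (imp e : {linear _ -> _}) => v.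
  by exists (val v); apply: impK.
move=> N P g h gsurj.
have /choice [x gx] i := gsurj (h (imp e (delta_mx 0 i))).
pose k (v : im e) := \sum_i val v 0 i *: x i.
have k_lin : linear k.
  move=> a u v; rewrite /k scaler_sumr -big_split /=; apply: eq_bigr => i _.
  by rewrite !mxE scalerDl scalerA.
exists (HB.pack_for {linear im e -> N} k (GRing.isLinear.Build R _ _ _ k k_lin)).
move=> v /=; rewrite /k linear_sum /= -[in RHS](impK v).
rewrite [in RHS](row_sum_delta (val v)) !linear_sum /=.
by apply: eq_bigr => i _; rewrite !linearZ /= gx.
Qed.

Lemma fgproj_im (M : lmodType R) :
  finitely_generated M -> projective M -> exists e : idem, lmod_iso (im e) M.
Proof.
move=> [n [p psurj]] /(_ _ _ p (@idfun M) psurj) [s ps].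
have mE v : v *m lin1_mx (s \o p) = s (p v) by rewrite mul_rV_lin1.
have m_idem : lin1_mx (s \o p) *m lin1_mx (s \o p) = lin1_mx (s \o p).
  apply/row_matrixP => i; rewrite !rowE mulmxA !mE.
  by have /= -> := ps (p (delta_mx 0 i)).
pose e := Idem m_idem; exists e.
pose f (v : im e) := p (val v).
have f_lin : linear f by move=> a u v; rewrite /f /= linearP.
exists (HB.pack_for {linear im e -> M} f (GRing.isLinear.Build R _ _ _ f f_lin)).
have sP y : s y \in im_pred e by rewrite inE /= mE; have /= -> := ps y.
exists (fun y => Im (sP y)) => [v | y]; last exact: ps.
by apply: val_inj; rewrite /= -mE -[RHS]im_fix.
Qed.

Fact idem_add_subproof (e f : idem) :
  let m : 'M_(idim e + idim f) := block_mx e 0 0 f in m *m m = m.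
Proof.
by rewrite /= mulmx_block !mulmx0 !mul0mx !imx_idem !addr0 !add0r.
Qed.
Definition idem_add (e f : idem) : idem := Idem (idem_add_subproof e f).

Fact idem0_subproof : (0 : 'M[R]_0) *m (0 : 'M[R]_0) = 0.
Proof. by rewrite mul0mx. Qed.
Definition idem0 : idem := Idem idem0_subproof.

Lemma im_add e f : lmod_iso (im (idem_add e f)) (im e * im f)%type.
Proof.
have inP (v : im (idem_add e f)) :
    lsubmx (val v : 'rV_(_ + _)) *m e = lsubmx (val v : 'rV_(_ + _))
    /\ rsubmx (val v : 'rV_(_ + _)) *m f = rsubmx (val v : 'rV_(_ + _)).
  have := im_fix v; rewrite /= -{1 2}[val v](@hsubmxK R 1 (idim e) (idim f)).
  rewrite mul_row_block !mulmx0 add0r addr0.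
  by move=> /(@eq_row_mx R 1 (idim e) (idim f)) [].
pose h (v : im (idem_add e f)) : im e * im f :=
  (imp e (lsubmx (val v : 'rV_(idim e + idim f))),
   imp f (rsubmx (val v : 'rV_(idim e + idim f)))).
have h_lin : linear h by move=> a u v; rewrite /h /= !linearP.
exists (HB.pack_for {linear im (idem_add e f) -> (im e * im f)%type} h
  (GRing.isLinear.Build R _ _ _ h h_lin)).
exists (fun w => imp (idem_add e f) (row_mx (val w.1) (val w.2))) => [v | [u w]].
  apply: val_inj; rewrite /= mul_row_block !mulmx0 add0r addr0.
  have [lv rv] := inP v.
  by rewrite !lv !rv hsubmxK.
rewrite /= /h /= mul_row_block !mulmx0 add0r addr0 row_mxKl row_mxKr !im_fix.
by congr (_, _); apply: impK.
Qed.

Lemma im_0 (v : im idem0) : v = 0.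
Proof. by apply: val_inj; apply/rowP => -[]. Qed.

HB.instance Definition _ := gen_eqMixin idem.
HB.instance Definition _ := gen_choiceMixin idem.

Definition isob (e f : idem) : bool := `[< lmod_iso (im e) (im f) >].

Lemma isob_refl : reflexive isob.
Proof. by move=> e; apply/asboolP/lmod_iso_refl. Qed.
Lemma isob_sym : symmetric isob.
Proof. by move=> e f; apply/asboolP/asboolP => /lmod_iso_sym. Qed.
Lemma isob_trans : transitive isob.
Proof. by move=> f e g /asboolP ef /asboolP fg; apply/asboolP/(lmod_iso_trans ef). Qed.

Canonical isob_equiv := EquivRel isob isob_refl isob_sym isob_trans.

Definition V := {eq_quot isob_equiv}.
HB.instance Definition _ := Choice.on V.
HB.instance Definition _ := EqQuotient.on V.

Local Notation cl := (\pi_V).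

Lemma V_eqP e f : cl e = cl f <-> lmod_iso (im e) (im f).
Proof. by split=> [/eqmodP/asboolP // | ef]; apply/eqmodP/asboolP. Qed.

Definition vadd (x y : V) : V := cl (idem_add (repr x) (repr y)).

Lemma lmod_iso_prod (M M' N N' : lmodType R) :
  lmod_iso M M' -> lmod_iso N N' -> lmod_iso (M * N)%type (M' * N')%type.
Proof.
move=> [f [f' fK f'K]] [g [g' gK g'K]].
pose h (x : M * N) := (f x.1, g x.2).
have h_lin : linear h by move=> a u v; rewrite /h /= !linearP.
exists (HB.pack_for {linear (M * N)%type -> (M' * N')%type} h
  (GRing.isLinear.Build R _ _ _ h h_lin)).
by exists (fun x => (f' x.1, g' x.2)) => -[x y]; rewrite /= /h /= ?fK ?f'K ?gK ?g'K.
Qed.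

Lemma im_add_iso e e' f f' :
    lmod_iso (im e) (im e') -> lmod_iso (im f) (im f') ->
  lmod_iso (im (idem_add e f)) (im (idem_add e' f')).
Proof.
move=> ee' ff'; apply: lmod_iso_trans (im_add e f) _.
exact: lmod_iso_trans (lmod_iso_prod ee' ff') (lmod_iso_sym (im_add e' f')).
Qed.

Lemma vaddE e f : vadd (cl e) (cl f) = cl (idem_add e f).
Proof. by apply/V_eqP/im_add_iso; apply/V_eqP; rewrite reprK. Qed.

Lemma vaddA : associative vadd.
Proof.
elim/quotW=> e; elim/quotW=> f; elim/quotW=> g.
rewrite (vaddE e f) (vaddE f g) !vaddE; apply/V_eqP.
apply: lmod_iso_trans (im_add _ _) _.
apply: lmod_iso_trans (lmod_iso_prod (lmod_iso_refl _) (im_add _ _)) _.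
apply: lmod_iso_sym; apply: lmod_iso_trans (im_add _ _) _.
apply: lmod_iso_trans (lmod_iso_prod (im_add _ _) (lmod_iso_refl _)) _.
pose h (x : im e * im f * im g) := (x.1.1, (x.1.2, x.2)).
have h_lin : linear h by [].
exists (HB.pack_for {linear (im e * im f * im g)%type -> _} h
  (GRing.isLinear.Build R _ _ _ h h_lin)).
by exists (fun x => (x.1, x.2.1, x.2.2)) => [[[]] | [? []]].
Qed.

Lemma vaddC : commutative vadd.
Proof.
elim/quotW=> e; elim/quotW=> f; rewrite !vaddE; apply/V_eqP.
apply: lmod_iso_trans (im_add _ _) _.
apply: lmod_iso_sym; apply: lmod_iso_trans (im_add _ _) _.
pose h (x : im f * im e) := (x.2, x.1).
have h_lin : linear h by [].
exists (HB.pack_for {linear (im f * im e)%type -> _} h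
  (GRing.isLinear.Build R _ _ _ h h_lin)).
by exists (fun x => (x.2, x.1)) => -[].
Qed.

Lemma vadd0 : left_id (cl idem0) vadd.
Proof.
elim/quotW=> e; rewrite vaddE; apply/V_eqP.
apply: lmod_iso_trans (im_add _ _) _.
pose h (x : im idem0 * im e) := x.2.
have h_lin : linear h by [].
exists (HB.pack_for {linear (im idem0 * im e)%type -> _} h
  (GRing.isLinear.Build R _ _ _ h h_lin)).
by exists (fun x => (0, x)) => // -[x y]; rewrite [x]im_0.
Qed.

HB.instance Definition _ := GRing.isNmodule.Build V vaddA vaddC vadd0.

End FgProj.

Section Grothendieck.
Variable M : nmodType.

Definition grothb (x y : M * M) : bool :=
  `[< exists k, x.1 + y.2 + k = y.1 + x.2 + k >].

Lemma grothb_refl : reflexive grothb.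
Proof. by move=> x; apply/asboolP; exists 0. Qed.
Lemma grothb_sym : symmetric grothb.
Proof. by move=> x y; apply/asboolP/asboolP => -[k xy]; exists k. Qed.
Lemma grothb_trans : transitive grothb.
Proof.
move=> y x z /asboolP[k xy] /asboolP[l yz]; apply/asboolP.
exists (y.1 + y.2 + k + l).
rewrite (AC (2*4) ((1*4*5)*(3*2*6))) /= xy yz.
by rewrite (AC (3*3) ((4*2)*(1*5*3*6))).
Qed.

Canonical groth_equiv := EquivRel grothb grothb_refl grothb_sym grothb_trans.

Definition groth := {eq_quot groth_equiv}.
HB.instance Definition _ := Choice.on groth.
HB.instance Definition _ := EqQuotient.on groth.

Local Notation cl := (\pi_groth).

Lemma groth_eqP x y :
  cl x = cl y <-> exists k, x.1 + y.2 + k = y.1 + x.2 + k.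
Proof. by split=> [/eqmodP/asboolP // | xy]; apply/eqmodP/asboolP. Qed.

Lemma groth_repr x :
  exists k, (repr (cl x)).1 + x.2 + k = x.1 + (repr (cl x)).2 + k.
Proof. by apply/groth_eqP; rewrite reprK. Qed.

Definition gadd (x y : groth) : groth :=
  cl ((repr x).1 + (repr y).1, (repr x).2 + (repr y).2).
Definition gopp (x : groth) : groth := cl ((repr x).2, (repr x).1).

Lemma gaddE x y : gadd (cl x) (cl y) = cl (x.1 + y.1, x.2 + y.2).
Proof.
have [k xk] := groth_repr x; have [l yl] := groth_repr y.
apply/groth_eqP; exists (k + l) => /=.
rewrite (AC (2*2*2) ((1*3*5)*(2*4*6))) /= xk yl.
by rewrite (AC (3*3) ((1*4)*(2*5)*(3*6))).
Qed.

Lemma goppE x : gopp (cl x) = cl (x.2, x.1).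
Proof.
have [k xk] := groth_repr x; apply/groth_eqP; exists k => /=.
by rewrite [_ + x.1]addrC -xk [x.2 + _]addrC.
Qed.

Lemma gaddA : associative gadd.
Proof.
elim/quotW=> x; elim/quotW=> y; elim/quotW=> z.
by rewrite (gaddE x y) (gaddE y z) !gaddE /= !addrA.
Qed.
Lemma gaddC : commutative gadd.
Proof.
elim/quotW=> x; elim/quotW=> y.
by rewrite !gaddE [x.1 + _]addrC [x.2 + _]addrC.
Qed.
Lemma gadd0 : left_id (cl (0, 0)) gadd.
Proof. by elim/quotW=> -[x y]; rewrite gaddE /= !add0r. Qed.
Lemma gaddN : left_inverse (cl (0, 0)) gopp gadd.
Proof.
elim/quotW=> x; rewrite goppE gaddE; apply/groth_eqP; exists 0 => /=.
by rewrite !addr0 add0r addrC.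
Qed.

HB.instance Definition _ := GRing.isZmodule.Build groth gaddA gaddC gadd0 gaddN.

End Grothendieck.

Definition K0 (R : pzRingType) : zmodType := groth (V R).

Definition zmod_iso (A B : zmodType) : Prop :=
  exists f : {additive A -> B}, bijective f.

Definition cyclic_zmod (A : zmodType) : Prop :=
  exists g : A, forall x, exists k : int, x = g *~ k.

(* The cyclic group of order k for k > 0. Not 'Z_k, which for k = 1 is a ring
   with two elements. *)
Definition Zmod (k : nat) : zmodType := 'I_k.-1.+1.

(* The vertex v_(i+1) is i : 'I_n; the edge e_(i+1) is inl i, and f_(i+1) is
   inr i. ordS is the successor modulo n. *)
Definition C2 (n : nat) : digraph :=
  {| vertex := 'I_n;
     edge := ('I_n + 'I_n)%type;
     src := fun x => match x with inl i | inr i => i end;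
     tgt := fun x => match x with inl i => ordS i | inr i => ordS (ordS i) end |}.

Definition incidence_C2 (n : nat) : 'M[int]_n :=
  \matrix_(i, k)
    #|[set x : edge (C2 n) | (src x == i) && (tgt x == k)]|%:Z.

Definition H2 (n : nat) : nat := `|\det (1%:M - (incidence_C2 n)^T)|%N.

Fixpoint fib (n : nat) : nat :=
  if n is n1.+1 then if n1 is n2.+1 then (fib n1 + fib n2)%N else 1%N else 0%N.

(* Over int, since fib 0 - 1 is negative. *)
Definition d (n : nat) : nat := `|gcdz (fib n)%:Z ((fib n.-1)%:Z - 1)|%N.

(* Main.v *)
(* For a finite graph E without sinks, K0 of L = L_K(E) is Z^V / (1 - A^t) Z^V, where
   V is the vertex set and A the incidence matrix. Let R be the span of the ghost
   paths in L, a free path algebra, with augmentation ideal J spanned by the ghost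
   edges. Each x in L satisfies c^* x in R for all long enough paths c, and 1 is the
   sum of the c c^* over the paths c of a given length.

   Generation: the image of an idempotent matrix over L is spanned by finitely many
   rows with entries in R. By Cohn's weak algorithm (cancelling R-dependent leading
   forms) the rows can be made R-independent; they are then L-independent, so every
   finitely generated projective module is a direct sum of modules L v.

   Relations: an isomorphism between two such sums, multiplied by long ghost paths,
   embeds one free R-module into another with a quotient Q of finite dimension
   vector q. Comparing T > S > JS with T > JT > JS for the big module T and the small
   module S shows that the classes differ by (1 - A^t) q.

   For C_n^2, let h_k be the class of the k-th predecessor of v_1. The relations read
   h_{k+2} = h_{k+1} + h_k with h_{k+n} = h_k, so K0 = Z^2 / M Z^2, with M having rows
   (F(n+1) - 1, F(n)) and (F(n), F(n-1) - 1). The entries of M have gcd d(n), and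
   |det M| = H_2(n), by factoring 1 - P - P^2 = (1 - t P)(1 - t' P) over the roots of
   X^2 = X + 1 for the cyclic permutation matrix P. *)

Require Import Defs.
From HB Require Import structures.
From mathcomp Require Import all_boot all_order all_algebra generic_quotient all_field.
From mathcomp Require Import boolp zify ring.

Set Implicit Arguments.
Unset Strict Implicit.
Unset Printing Implicit Defensive.

Import Order.TTheory GRing.Theory Num.Theory.
Local Open Scope ring_scope.
Local Open Scope quotient_scope.

(** * Leavitt path algebras *)

Section LeavittRelations.
Variables (K : fieldType) (E : digraph).
Local Notation L := (leavitt K E).

Definition lvert (v : vertex E) : L := lgen K (Vertex v).
Definition lreal (e : edge E) : L := lgen K (Edge e).
Definition lghost (e : edge E) : L := lgen K (Ghost e).

Lemma pmulrE (x y : L) : pmul x y = x * y.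
Proof. by []. Qed.

Lemma lscaleAl a (x y : L) : a *: (x * y) = (a *: x) * y.
Proof. exact: pscaleAl. Qed.
Lemma lscaleAr a (x y : L) : a *: (x * y) = x * (a *: y).
Proof. exact: pscaleAr. Qed.

Lemma leavitt_relE s t : leavitt_rel s t ->
  \pi_(presented (@leavitt_rel K E)) s = \pi_(presented (@leavitt_rel K E)) t.
Proof. by move=> st; apply/presented_eqP/cong_rel. Qed.

Lemma lvertM v w : lvert v * lvert w = if v == w then lvert v else 0.
Proof. exact: lgen_V. Qed.
Lemma lvertMid v : lvert v * lvert v = lvert v.
Proof. by rewrite lvertM eqxx. Qed.

Lemma src_lreal e : lvert (src e) * lreal e = lreal e.
Proof. by rewrite -pmulrE pmulE (leavitt_relE (rel_E1s _ _)). Qed.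
Lemma lreal_tgt e : lreal e * lvert (tgt e) = lreal e.
Proof. by rewrite -pmulrE pmulE (leavitt_relE (rel_E1r _ _)). Qed.
Lemma tgt_lghost e : lvert (tgt e) * lghost e = lghost e.
Proof. by rewrite -pmulrE pmulE (leavitt_relE (rel_E2r _ _)). Qed.
Lemma lghost_src e : lghost e * lvert (src e) = lghost e.
Proof. by rewrite -pmulrE pmulE (leavitt_relE (rel_E2s _ _)). Qed.
Lemma lghost_lreal e f :
  lghost e * lreal f = if e == f then lvert (tgt e) else 0.
Proof.
by rewrite -pmulrE pmulE (leavitt_relE (rel_CK1 _ _ _)); case: ifP.
Qed.

Lemma sum_lvert : \sum_v lvert v = 1.
Proof. by []. Qed.

Lemma lvert_ghost v e : lvert v * lghost e = if v == tgt e then lghost e else 0.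
Proof.
rewrite -{1}tgt_lghost mulrA lvertM; case: eqP => [->|_]; last exact: mul0r.
exact: tgt_lghost.
Qed.
Lemma ghost_lvert v e : lghost e * lvert v = if v == src e then lghost e else 0.
Proof.
rewrite -{1}lghost_src -mulrA lvertM eq_sym; case: eqP => [e_v|_]; last exact: mulr0.
exact: lghost_src.
Qed.
Lemma lvert_real v e : lvert v * lreal e = if v == src e then lreal e else 0.
Proof.
rewrite -{1}src_lreal mulrA lvertM; case: eqP => [->|_]; last exact: mul0r.
exact: src_lreal.
Qed.

Lemma pi_Add_sum (I : finType) (P : pred I) (F : I -> term K (leavitt_gen E)) :
  \pi_(presented (@leavitt_rel K E)) (\big[@Add _ _/Zero]_(i | P i) F i) =
  \sum_(i | P i) \pi_(presented (@leavitt_rel K E)) (F i).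
Proof.
have piD : {morph (fun t => \pi_(presented (@leavitt_rel K E)) t) : s t / Add s t >-> s + t}.
  by move=> s t; rewrite -paddE.
exact: (big_morph _ piD).
Qed.

Hypothesis no_sink : forall v : vertex E, exists e : edge E, src e = v.

Lemma lvert_sum v : \sum_(e | src e == v) lreal e * lghost e = lvert v.
Proof.
rewrite /lvert /lgen (leavitt_relE (rel_CK2 K _)); last first.
  have [e ev] := no_sink v; apply/card_gt0P; exists e.
  by rewrite inE ev.
by rewrite pi_Add_sum; apply: eq_bigr => e _; rewrite -pmulrE pmulE.
Qed.

Lemma sum_real_ghost : \sum_e lreal e * lghost e = 1.
Proof.
rewrite -sum_lvert (partition_big (@src E) xpredT) //=.
by apply: eq_bigr => v _; rewrite -lvert_sum.
Qed.

Lemma leavitt_ind (P : L -> Prop) :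
  (forall v, P (lvert v)) -> (forall e, P (lreal e)) -> (forall e, P (lghost e)) ->
  P 0 -> (forall x y, P x -> P y -> P (x + y)) ->
  (forall a x, P x -> P (a *: x)) -> (forall x y, P x -> P y -> P (x * y)) ->
  forall x, P x.
Proof.
move=> Pv Pr Pg P0 PD PZ PM; apply: presented_ind => //.
by case=> [v|e|e]; [apply: Pv | apply: Pr | apply: Pg].
Qed.

(** Because 1 is the sum of the [e e^*], vanishing can be tested after applying every ghost edge. *)
Lemma lghost_inj (x : L) : (forall e, lghost e * x = 0) -> x = 0.
Proof.
move=> gx; rewrite -[x]mul1r -sum_real_ghost mulr_suml big1 // => e _.
by rewrite -mulrA gx mulr0.
Qed.

End LeavittRelations.
Arguments lvert K {E}.
Arguments lreal K {E}.
Arguments lghost K {E}.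

(** * The representation on infinite paths *)

Section PathRepresentation.
Variables (K : fieldType) (E : digraph).
Local Notation L := (leavitt K E).
Local Notation vec := ((nat -> edge E) -> int -> K).

Definition is_walk (x : nat -> edge E) := `[< forall i, src (x i.+1) = tgt (x i) >].
Definition wtail (x : nat -> edge E) : nat -> edge E := fun i => x i.+1.
Definition wcons e (x : nat -> edge E) : nat -> edge E :=
  fun i => if i is j.+1 then x j else e.

Lemma wconsK x : wcons (x 0%N) (wtail x) = x.
Proof. by apply/funext => -[]. Qed.
Lemma wtail_cons e x : wtail (wcons e x) = x.
Proof. by []. Qed.

Lemma is_walk_cons e x : is_walk (wcons e x) = (src (x 0%N) == tgt e) && is_walk x.
Proof.
apply/asboolP/andP => [w|[/eqP s0 /asboolP w] [|i]] //=.
by split; [apply/eqP/(w 0%N) | apply/asboolP => i; apply: (w i.+1)].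
Qed.

Lemma is_walk_tail x : is_walk x -> is_walk (wtail x).
Proof. by rewrite -{1}(wconsK x) is_walk_cons => /andP[]. Qed.

(* The second argument of a vector records a degree: edges raise it and ghost
   edges lower it, so that paths of different lengths never interfere. *)
Definition gen_act (g : leavitt_gen E) (xi : vec) : vec := fun x d =>
  match g with
  | Vertex v => if is_walk x && (src (x 0%N) == v) then xi x d else 0
  | Edge e => if is_walk x && (x 0%N == e) then xi (wtail x) (d + 1) else 0
  | Ghost e => if is_walk (wcons e x) then xi (wcons e x) (d - 1) else 0
  end.

Fixpoint term_act (t : term K (leavitt_gen E)) (xi : vec) : vec :=
  match t with
  | Gen g => gen_act g xi
  | Zero => fun _ _ => 0
  | Add s t => fun x d => term_act s xi x d + term_act t xi x d
  | Scale a t => fun x d => a * term_act t xi x d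
  | Mul s t => term_act s (term_act t xi)
  end.

(** Linearity of each operator is what the distributive and scalar laws of [cong] require in
    [term_act_cong]. *)
Lemma term_act_linear t a (xi zeta : vec) :
  term_act t (fun x d => a * xi x d + zeta x d) =
  (fun x d => a * term_act t xi x d + term_act t zeta x d).
Proof.
elim: t xi zeta => [g||s IHs t IHt|b t IHt|s IHs t IHt] xi zeta /=.
- by apply/funext => x; apply/funext => d; case: g => [v|e|e] /=; case: ifP;
    rewrite // mulr0 addr0.
- by apply/funext => x; apply/funext => d; rewrite mulr0 addr0.
- apply/funext => x; apply/funext => d; rewrite IHs IHt; ring.
- by apply/funext => x; apply/funext => d; rewrite IHt; ring.
- by rewrite IHt IHs.
Qed.

Lemma term_act_add t (xi zeta : vec) :
  term_act t (fun x d => xi x d + zeta x d) =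
  (fun x d => term_act t xi x d + term_act t zeta x d).
Proof.
have := term_act_linear t 1 xi zeta.
under [X in term_act t X]eq_fun do under eq_fun do rewrite mul1r.
by move->; apply/funext => x; apply/funext => d; rewrite mul1r.
Qed.

Lemma term_act0 t : term_act t (fun _ _ => 0) = (fun _ _ => 0).
Proof.
have := term_act_linear t (-1) (fun _ _ => 0) (fun _ _ => 0).
under [X in term_act t X]eq_fun do under eq_fun do rewrite mulr0 addr0.
by move->; apply/funext => x; apply/funext => d; rewrite mulN1r addNr.
Qed.

Lemma term_act_scale t a (xi : vec) :
  term_act t (fun x d => a * xi x d) = (fun x d => a * term_act t xi x d).
Proof.
have := term_act_linear t a xi (fun _ _ => 0).
under [X in term_act t X]eq_fun do under eq_fun do rewrite addr0.
by move->; apply/funext => x; apply/funext => d; rewrite term_act0 addr0.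
Qed.

Lemma term_act_sum (I : Type) (r : seq I) P (F : I -> term K (leavitt_gen E)) xi x d :
  term_act (\big[@Add _ _/Zero]_(i <- r | P i) F i) xi x d =
  \sum_(i <- r | P i) term_act (F i) xi x d.
Proof.
by elim: r => [|i r IH]; rewrite ?big_nil // !big_cons; case: (P i); rewrite //= IH.
Qed.

Lemma term_act_rel s t : leavitt_rel s t -> term_act s = term_act t.
Proof.
move=> st; apply/funext => xi; apply/funext => x; apply/funext => d.
case: s t / st => [v w|e|e|e|e|e f|v _] /=.
- case: (eqVneq v w) => [<-|v_w] /=; first by case: ifP => // ->.
  case: ifP => // /andP[_ /eqP x_v]; case: ifP => // /andP[_ /eqP x_w].
  by case/eqP: v_w; rewrite -x_v.
- case: (boolP (is_walk x)) => //= w_x.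
  by case: (eqVneq (x 0%N) e) => [->|_]; rewrite ?eqxx // if_same.
- case: (boolP (is_walk x)) => //= w_x; case: eqVneq => [<-|//].
  rewrite is_walk_tail //= ifT //.
  by move: w_x; rewrite -{1}(wconsK x) is_walk_cons => /andP[].
- by rewrite is_walk_cons; case: (is_walk x); rewrite ?andbF ?andbT //=; case: eqP.
- by rewrite eqxx andbT; case: ifP => // ->.
- rewrite is_walk_cons wtail_cons subrK; case: (eqVneq e f) => /= _; last by rewrite andbF if_same.
  by rewrite andbT andbC; case: ifP => // ->.
(* For CK2, a path starting at [v] meets exactly one summand, that of its first edge. *)
- rewrite term_act_sum /=.
  case: (boolP (is_walk x)) => /= w_x; last by rewrite big1.
  rewrite -big_mkcondr /=; case: (eqVneq (src (x 0%N)) v) => [<-|x0]; last first.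
    by rewrite big_pred0 // => e; apply/negP => /andP[/eqP ev /eqP ex]; rewrite ex ev eqxx in x0.
  rewrite (big_pred1 (x 0%N)) => [|e]; first by rewrite wconsK w_x addrK.
  by rewrite /= andbC [e == _]eq_sym; case: (eqVneq (x 0%N) e) => // ->; rewrite eqxx.
Qed.

Lemma term_act_cong s t : cong (@leavitt_rel K E) s t -> term_act s = term_act t.
Proof.
elim=> {s t} /=; try by move=> *; congruence.
all: try by move=> *; apply/funext => xi; apply/funext => x; apply/funext => d;
  rewrite ?term_act_add ?term_act_scale /=; ring.
- exact: term_act_rel.
- by move=> s s' t t' _ -> _ ->.
- by move=> a t t' _ ->.
- by move=> s s' t t' _ -> _ ->.
Qed.

Definition lact (x : L) : vec -> vec := term_act (repr x).

Lemma lact_pi t : lact (\pi_(presented (@leavitt_rel K E)) t) = term_act t.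
Proof. exact/term_act_cong/cong_repr. Qed.

Lemma lactD x y xi w d : lact (x + y) xi w d = lact x xi w d + lact y xi w d.
Proof. by rewrite -[x + y]/(padd x y) /padd lact_pi. Qed.
Lemma lact0 xi w d : lact 0 xi w d = 0.
Proof. by rewrite -[0]/(\pi_(presented (@leavitt_rel K E)) Zero) lact_pi. Qed.
Lemma lactZ a x xi w d : lact (a *: x) xi w d = a * lact x xi w d.
Proof. by rewrite -[a *: x]/(pscale a x) /pscale lact_pi. Qed.
Lemma lactM x y xi w d : lact (x * y) xi w d = lact x (lact y xi) w d.
Proof. by rewrite -[x * y]/(pmul x y) /pmul lact_pi. Qed.
Lemma lact_sum (I : finType) (P : pred I) (F : I -> L) xi w d :
  lact (\sum_(i | P i) F i) xi w d = \sum_(i | P i) lact (F i) xi w d.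
Proof.
apply: (big_morph (fun x => lact x xi w d)) => [x y|]; [exact: lactD | exact: lact0].
Qed.
Lemma lact_vert v xi w d :
  lact (lvert K v) xi w d = if is_walk w && (src (w 0%N) == v) then xi w d else 0.
Proof. by rewrite /lvert /lgen lact_pi. Qed.
Lemma lact_ghost e xi w d :
  lact (lghost K e) xi w d = if is_walk (wcons e w) then xi (wcons e w) (d - 1) else 0.
Proof. by rewrite /lghost /lgen lact_pi. Qed.

End PathRepresentation.

(** * Ghost polynomials *)

Section GhostPolynomials.
Variables (K : fieldType) (E : digraph).
Local Notation L := (leavitt K E).
Local Notation vec := ((nat -> edge E) -> int -> K).

(** A constant part, and a tail after each leading ghost edge. The condition
    [lvert K (src e) * y e = y e] makes polynomial tails unique in the absence of sinks
    ([ghost_comb_inj]): the ghost path algebra R is free. *)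
Definition ghost_comb (k : vertex E -> K) (y : edge E -> L) : L :=
  \sum_v k v *: lvert K v + \sum_e lghost K e * y e.

(* Combinations of ghost paths of length less than d. *)
Fixpoint gpoly (d : nat) (x : L) : Prop :=
  if d is d'.+1 then
    exists k y, [/\ forall e, gpoly d' (y e),
                    forall e, lvert K (src e) * y e = y e & x = ghost_comb k y]
  else x = 0.

Lemma lvert_comb v (k : vertex E -> K) (y : edge E -> L) :
  lvert K v * ghost_comb k y =
  k v *: lvert K v + \sum_(e | v == tgt e) lghost K e * y e.
Proof.
rewrite mulrDr !mulr_sumr [in RHS]big_mkcond; congr (_ + _).
  rewrite (bigD1 v) //= -lscaleAr lvertMid big1 ?addr0 // => w /negPf wv.
  by rewrite -lscaleAr lvertM eq_sym wv scaler0.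
by apply: eq_bigr => e _; rewrite mulrA lvert_ghost; case: ifP; rewrite ?mul0r.
Qed.

Lemma ghost_combE (y : edge E -> L) e : lvert K (src e) * y e = y e ->
  ghost_comb (fun _ => 0) (fun f => if f == e then y e else 0) = lghost K e * y e.
Proof.
move=> ye; rewrite /ghost_comb big1 ?add0r; last by move=> *; rewrite scale0r.
by rewrite (bigD1 e) //= eqxx big1 ?addr0 // => f /negPf ->; rewrite mulr0.
Qed.

Lemma gpoly0 d : gpoly d 0.
Proof.
elim: d => [//|d IH] /=; exists (fun _ => 0), (fun _ => 0); split=> // [e|].
  by rewrite mulr0.
by rewrite /ghost_comb !big1 ?addr0 // => *; rewrite ?scale0r ?mulr0.
Qed.

Lemma gpolyD d x y : gpoly d x -> gpoly d y -> gpoly d (x + y).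
Proof.
elim: d x y => [|d IH] x y /=; first by move=> -> ->; rewrite addr0.
move=> [k [u [ud ue ->]]] [l [w [wd we ->]]].
exists (fun v => k v + l v), (fun e => u e + w e); split=> [e|e|].
- exact: IH.
- by rewrite mulrDr ue we.
- rewrite /ghost_comb addrACA -!big_split /=; congr (_ + _); apply: eq_bigr => i _.
    by rewrite scalerDl.
  by rewrite mulrDr.
Qed.

Lemma gpolyZ d a x : gpoly d x -> gpoly d (a *: x).
Proof.
elim: d x => [|d IH] x /=; first by move=> ->; rewrite scaler0.
move=> [k [u [ud ue ->]]]; exists (fun v => a * k v), (fun e => a *: u e).
split=> [e|e|]; first exact: IH.
- by rewrite -lscaleAr ue.
- rewrite /ghost_comb scalerDr !scaler_sumr; congr (_ + _); apply: eq_bigr => i _.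
    by rewrite scalerA.
  by rewrite lscaleAr.
Qed.

Lemma gpolyN d x : gpoly d x -> gpoly d (- x).
Proof. by rewrite -scaleN1r; apply: gpolyZ. Qed.

Lemma gpoly_sum d (I : finType) (P : pred I) (F : I -> L) :
  (forall i, P i -> gpoly d (F i)) -> gpoly d (\sum_(i | P i) F i).
Proof. by move=> FP; apply: (big_ind (gpoly d)) => //; [exact: gpoly0 | exact: gpolyD]. Qed.

Lemma gpolyS d x : gpoly d x -> gpoly d.+1 x.
Proof.
elim: d x => [|d IH] x; first by move=> /= ->; apply: (gpoly0 1).
move=> [k [u [ud ue ->]]]; exists k, u; split=> // e; exact/IH/ud.
Qed.

Lemma gpoly_le d d' x : (d <= d')%N -> gpoly d x -> gpoly d' x.
Proof.
by move=> /subnK <-; elim: (d' - d)%N => [//|n IH] /IH; apply: gpolyS.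
Qed.

Lemma gpoly_vert v : gpoly 1 (lvert K v).
Proof.
exists (fun w => (w == v)%:R), (fun _ => 0); split=> // [e|]; first by rewrite mulr0.
rewrite /ghost_comb [X in _ + X]big1 ?addr0; last by move=> *; rewrite mulr0.
rewrite (bigD1 v) //= eqxx scale1r big1 ?addr0 // => w /negPf ->.
by rewrite scale0r.
Qed.

Lemma gpoly_vertM d v x : gpoly d x -> gpoly d (lvert K v * x).
Proof.
case: d x => [|d] x; first by move=> /= ->; rewrite mulr0.
move=> [k [u [ud ue ->]]]; rewrite lvert_comb.
apply: gpolyD; first exact/gpolyZ/(@gpoly_le 1)/gpoly_vert.
apply: gpoly_sum => e _.
exists (fun _ => 0), (fun f => if f == e then u e else 0); split=> [f|f|].
- by case: eqP => _; [apply: ud | apply: gpoly0].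
- by case: eqP => [->|_]; rewrite ?mulr0.
- by rewrite ghost_combE.
Qed.

Lemma gpoly_ghostM d e x : gpoly d x -> gpoly d.+1 (lghost K e * x).
Proof.
move=> xd; rewrite -lghost_src -mulrA.
exists (fun _ => 0), (fun f => if f == e then lvert K (src e) * x else 0).
split=> [f|f|].
- by case: eqP => _; [apply: gpoly_vertM | apply: gpoly0].
- by case: eqP => [->|_]; rewrite ?mulr0 // mulrA lvertMid.
- rewrite (@ghost_combE (fun e => lvert K (src e) * x)) //.
  by rewrite mulrA lvertMid.
Qed.

Lemma gpoly_ghost e : gpoly 2 (lghost K e).
Proof. by rewrite -lghost_src; apply/gpoly_ghostM/gpoly_vert. Qed.

Lemma gpolyM a b x y : gpoly a.+1 x -> gpoly b y -> gpoly (a + b) (x * y).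
Proof.
elim: a x => [|a IH] x [k [u [ud ue ->]]] yb;
    rewrite /ghost_comb mulrDl !mulr_suml; apply: gpolyD; apply: gpoly_sum => i _.
- by rewrite -lscaleAl; apply/gpolyZ/gpoly_vertM.
- by rewrite -mulrA ud mul0r mulr0; apply: gpoly0.
- rewrite -lscaleAl; apply/gpolyZ/gpoly_vertM; apply: gpoly_le yb; exact: leq_addl.
- by rewrite -mulrA addSn; apply/gpoly_ghostM/IH.
Qed.

Lemma gpolyM_pred a b x y : gpoly a x -> gpoly b y -> gpoly (a + b).-1 (x * y).
Proof.
case: a => [/= ->|a xa yb]; first by rewrite mul0r => _; apply: gpoly0.
exact: gpolyM.
Qed.

(* The points whose values determine those of a ghost polynomial at (y, d): the
   cones of distinct one-edge extensions of y are disjoint. *)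
Definition in_cone (y : nat -> edge E) (d : int) z d' : Prop :=
  exists n : nat, d' = d - n%:Z /\ iter n (@wtail E) z = y.

Lemma lact_gpoly_local n (x : L) (xi zeta : vec) y d : gpoly n x ->
  (forall z d', in_cone y d z d' -> xi z d' = zeta z d') ->
  lact x xi y d = lact x zeta y d.
Proof.
elim: n x y d => [|n IH] x y d /=; first by move=> -> _; rewrite !lact0.
move=> [k [u [ud ue ->]]] loc; rewrite !lactD !lact_sum.
congr (_ + _); apply: eq_bigr => i _.
  rewrite !lactZ !lact_vert; case: ifP => // _; rewrite loc //.
  by exists 0%N; rewrite subr0.
rewrite !lactM !lact_ghost; case: ifP => // _; apply: IH => // z d' [m [-> zy]].
apply: loc; exists m.+1; split; first by rewrite -addn1 PoszD opprD addrA addrAC.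
by rewrite iterS zy.
Qed.

Lemma lact_zero (x : L) w d : lact x (fun _ _ => 0) w d = 0.
Proof. by rewrite /lact term_act0. Qed.

Lemma ghost_comb_act k y (xi : vec) z d v : is_walk z -> src (z 0%N) = v ->
  lact (ghost_comb k y) xi z d =
  k v * xi z d + \sum_(e | v == tgt e) lact (y e) xi (wcons e z) (d - 1).
Proof.
move=> wz zv; rewrite lactD !lact_sum [in RHS]big_mkcond; congr (_ + _).
  rewrite (bigD1 v) //= lactZ lact_vert wz zv eqxx big1 ?addr0 // => w /negPf wv.
  by rewrite lactZ lact_vert zv wz /= eq_sym wv mulr0.
by apply: eq_bigr => e _; rewrite lactM lact_ghost is_walk_cons wz zv andbT.
Qed.

(** Test functions separate the terms: those supported on the cone over [wcons e z] isolate the tail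
    [y e], which is handled by induction; the constant function 1 then detects [k v]. *)
Lemma ghost_comb_eq0 n k (y : edge E -> L) z d v : is_walk z -> src (z 0%N) = v ->
  (forall e, gpoly n (y e)) -> (forall e, lvert K (src e) * y e = y e) ->
  (forall xi, lact (ghost_comb k y) xi z d = 0) ->
  k v = 0 /\ forall e, v = tgt e -> y e = 0.
Proof.
elim: n k y z d v => [|n IH] k y z d v wz zv yn ys act0.
  split; last by move=> e _; apply: yn.
  have := act0 (fun _ _ => 1); rewrite (ghost_comb_act _ _ _ _ wz zv) mulr1 big1 ?addr0 //.
  by move=> e _; rewrite yn lact0.
have y0 e : v = tgt e -> y e = 0.
  move=> ve; have yact xi : lact (y e) xi (wcons e z) (d - 1) = 0.
    (* Cutting [xi] down to this cone removes the value at [z], which sits in degree [d] rather than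
       at most [d - 1], and every tail other than [y e]. *)
    pose zeta z' d' := if `[< in_cone (wcons e z) (d - 1) z' d' >] then xi z' d' else 0.
    have := act0 zeta; rewrite (ghost_comb_act _ _ _ _ wz zv) /zeta.
    case: asboolP => [[m [dm _]]|_]; first by exfalso; lia.
    rewrite mulr0 add0r (bigD1 e) /=; last exact/eqP.
    rewrite [X in _ + X]big1 ?addr0 => [act_e|f /andP[_ /eqP fe]].
      rewrite -[RHS]act_e; apply: (lact_gpoly_local (yn e)) => z' d' cz.
      by case: asboolP.
    rewrite -[RHS](lact_zero (y f) (wcons f z) (d - 1)).
    apply: (lact_gpoly_local (yn f)) => z' d' [m [-> zm]].
    case: asboolP => // -[m' [dm zm']]; exfalso; apply: fe.
    have mm : m = m' by lia.
    by move: zm'; rewrite -mm zm => /(congr1 (fun w => w 0%N)).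
  (* Induction kills the coefficients of [y e] attached to [src e]; multiplication by [src e], which
     fixes [y e], removes the others. *)
  have [l [u [un us y_e]]] := yn e.
  have we : is_walk (wcons e z) by rewrite is_walk_cons wz zv ve eqxx.
  move: yact; rewrite y_e => /(IH _ _ _ _ _ we erefl un us)[l0 u0].
  rewrite -y_e -ys y_e lvert_comb l0 scale0r add0r big1 // => f /eqP sf.
  by rewrite (u0 f) ?mulr0.
split=> //; have := act0 (fun _ _ => 1).
rewrite (ghost_comb_act _ _ _ _ wz zv) mulr1 big1 ?addr0 // => e /eqP ve.
by rewrite y0 // lact0.
Qed.

Hypothesis no_sink : forall v : vertex E, exists e : edge E, src e = v.

Lemma exists_walk v : exists2 z : nat -> edge E, is_walk z & src (z 0%N) = v.
Proof.
have /choice[out out_src] := no_sink.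
exists (fun i => iter i (fun e => out (tgt e)) (out v)); last exact: out_src.
by apply/asboolP => i; apply: out_src.
Qed.

(** Without sinks every vertex starts an infinite path, so the path representation sees every
    coefficient. *)
Lemma ghost_comb_inj n k (y : edge E -> L) :
  (forall e, gpoly n (y e)) -> (forall e, lvert K (src e) * y e = y e) ->
  ghost_comb k y = 0 -> (forall v, k v = 0) /\ (forall e, y e = 0).
Proof.
move=> yn ys c0.
have act0 z xi : lact (ghost_comb k y) xi z 0 = 0 by rewrite c0 lact0.
have all v : k v = 0 /\ forall e, v = tgt e -> y e = 0.
  have [z wz zv] := exists_walk v.
  exact: (ghost_comb_eq0 wz zv yn ys (act0 z)).
by split=> [v|e]; [have [] := all v | have [_ ->] := all (tgt e)].
Qed.

(* Real paths become ghost paths once enough ghost edges are applied. *)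
Fixpoint tame (N : nat) (x : L) : Prop :=
  if N is N'.+1 then forall e, tame N' (lghost K e * x) else exists d, gpoly d x.

Lemma tameD N x y : tame N x -> tame N y -> tame N (x + y).
Proof.
elim: N x y => [|N IH] x y /= => [[d xd] [d' yd]|xN yN e].
  exists (d + d')%N; apply: gpolyD; first exact: gpoly_le (leq_addr _ _) xd.
  exact: gpoly_le (leq_addl _ _) yd.
by rewrite mulrDr; apply: IH.
Qed.

Lemma tameZ N a x : tame N x -> tame N (a *: x).
Proof.
elim: N x => [|N IH] x /= => [[d xd]|xN e]; first by exists d; apply: gpolyZ.
by rewrite -lscaleAr; apply: IH.
Qed.

Lemma tame_gpoly N d x : gpoly d x -> tame N x.
Proof.
elim: N d x => [|N IH] d x xd /=; first by exists d.
by move=> e; apply: (IH d.+1); apply: gpoly_ghostM.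
Qed.

Lemma tame_sum N (I : finType) (P : pred I) (F : I -> L) :
  (forall i, P i -> tame N (F i)) -> tame N (\sum_(i | P i) F i).
Proof.
move=> FP; apply: (big_ind (tame N)) => //; last exact: tameD.
exact: tame_gpoly (gpoly0 0).
Qed.

Lemma tame_vertM N v x : tame N x -> tame N (lvert K v * x).
Proof.
case: N => [[d xd]|N xN e]; first by exists d; apply: gpoly_vertM.
rewrite mulrA ghost_lvert; case: ifP => _; first exact: xN.
by rewrite mul0r; apply: tame_gpoly (gpoly0 0).
Qed.

Lemma tameS N x : tame N x -> tame N.+1 x.
Proof.
elim: N x => [|N IH] x /= xN e; first by have [d xd] := xN; exists d.+1; apply: gpoly_ghostM.
by apply: IH.
Qed.

Lemma tame_le N N' x : (N <= N')%N -> tame N x -> tame N' x.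
Proof. by move=> /subnK <-; elim: (N' - N)%N => [//|n IH] /IH; apply: tameS. Qed.

Lemma tame_ghostM N e x : tame N x -> tame N (lghost K e * x).
Proof. by move/tameS; apply. Qed.

Lemma tame_gpolyM N d x y : gpoly d x -> tame N y -> tame N (x * y).
Proof.
elim: d x => [|d IH] x.
  by move=> /= -> _; rewrite mul0r; apply: tame_gpoly (gpoly0 0).
move=> [k [u [ud ue ->]]] yN; rewrite mulrDl !mulr_suml.
apply: tameD; apply: tame_sum => i _.
  by rewrite -lscaleAl; apply/tameZ/tame_vertM.
by rewrite -mulrA; apply: tame_ghostM; apply: IH (ud i) yN.
Qed.

(** Applying [N] ghost edges turns [x] into a ghost polynomial, and left multiplication by one keeps
    [y] tame. *)
Lemma tameM N M x y : tame N x -> tame M y -> tame (N + M) (x * y).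
Proof.
elim: N x => [|N IH] x; first by move=> [d xd]; apply: tame_gpolyM xd.
by move=> xN yM; rewrite addSn /= => e; rewrite mulrA; apply: IH.
Qed.

Lemma tame_ex x : exists N, tame N x.
Proof.
elim/leavitt_ind: x => [v|e|e||x y [N xN] [M yM]|a x [N xN]|x y [N xN] [M yM]].
- by exists 0%N, 1%N; apply: gpoly_vert.
- exists 1%N => f /=; rewrite lghost_lreal; case: eqP => _.
    by exists 1%N; apply: gpoly_vert.
  by exists 0%N.
- by exists 0%N, 2%N; apply: gpoly_ghost.
- by exists 0%N, 0%N.
- exists (N + M)%N; apply: tameD; first exact: tame_le (leq_addr _ _) xN.
  exact: tame_le (leq_addl _ _) yM.
- by exists N; apply: tameZ.
- by exists (N + M)%N; apply: tameM.
Qed.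

End GhostPolynomials.

(** * The weak algorithm *)

Section WeakReduction.
Variables (K : fieldType) (E : digraph).
Local Notation L := (leavitt K E).
Hypothesis no_sink : forall v : vertex E, exists e : edge E, src e = v.

(** By uniqueness of tails, [w] agrees with the tails that witness the bound [D], and these have one
    degree less. *)
Lemma ghost_sum_gpoly n D (w : edge E -> L) :
  (forall e, gpoly n (w e)) -> (forall e, lvert K (src e) * w e = w e) ->
  gpoly D (\sum_e lghost K e * w e) -> forall e, gpoly D.-1 (w e).
Proof.
move=> wn ws; case: D => [|D] /=.
  move=> w0; have [|_ w_e] := @ghost_comb_inj K E no_sink n (fun _ => 0) w wn ws.
    by rewrite /ghost_comb big1 ?add0r // => v _; rewrite scale0r.
  by move=> e; rewrite w_e.
move=> [k [y [yD ys w_y]]] e.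
have [|||_ yw] := @ghost_comb_inj K E no_sink (n + D) k (fun e => y e - w e).
- move=> f; apply: gpolyD; first by apply: gpoly_le (yD f); rewrite leq_addl.
  by apply/gpolyN/gpoly_le/wn; rewrite leq_addr.
- by move=> f; rewrite mulrBr ys ws.
- rewrite /ghost_comb; under [X in _ + X]eq_bigr do rewrite mulrBr.
  by rewrite sumrB addrA w_y subrr.
by have /eqP := yw e; rewrite subr_eq0 => /eqP <-.
Qed.

(** * Independence of reduced families *)

Section Family.
Variables (I J : finType) (v : I -> vertex E) (d : I -> nat) (B : I -> J -> L).
Hypothesis B_gpoly : forall i b, gpoly (d i) (B i b).
Hypothesis B_vert : forall i b, lvert K (v i) * B i b = B i b.

(* No element can be lowered in degree by adding combinations of the others whose
   terms do not exceed its own degree. *)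
Definition reduced := forall j, (0 < d j)%N -> ~ exists s : I -> L,
  [/\ s j = 0, forall i, gpoly ((d j).+1 - d i) (s i) &
      forall b, gpoly (d j).-1 (B j b + \sum_i s i * B i b)].

Hypothesis B_reduced : reduced.

(** The bound leaves only a scalar in front of a generator of degree [D.+1]. If it were nonzero,
    dividing the relation by it would lower that generator, against [B_reduced]. *)
Lemma reduced_top D (r : I -> L) :
  (forall i, r i * lvert K (v i) = r i) ->
  (forall i, gpoly (D.+2 - d i) (r i)) ->
  (forall b, gpoly D (\sum_i r i * B i b)) ->
  forall i, d i = D.+1 -> r i = 0.
Proof.
move=> rv rD rB j dj.
have := rD j; rewrite dj subSnn => -[k [y [y0 _ rj]]].
have {}rj : r j = k (v j) *: lvert K (v j).
  rewrite -rv rj mulrDl !mulr_suml [X in _ + X]big1 ?addr0; last first.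
    by move=> e _; rewrite y0 mulr0 mul0r.
  rewrite (bigD1 (v j)) //= -lscaleAl lvertMid big1 ?addr0 // => w /negPf wv.
  by rewrite -lscaleAl lvertM wv scaler0.
case: (eqVneq (k (v j)) 0) => [k0|k_n0]; first by rewrite rj k0 scale0r.
exfalso; apply: (@B_reduced j); first by rewrite dj.
exists (fun i => if i == j then 0 else (k (v j))^-1 *: r i); split=> [|i|b].
- by rewrite eqxx.
- by rewrite dj; case: ifP => _; [apply: gpoly0 | apply: gpolyZ].
- rewrite dj /=.
  have -> : B j b + \sum_i (if i == j then 0 else (k (v j))^-1 *: r i) * B i b =
            (k (v j))^-1 *: \sum_i r i * B i b; last exact/gpolyZ.
  rewrite (bigD1 j) //= eqxx mul0r add0r [in RHS](bigD1 j) //= scalerDr.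
  rewrite {1}rj -lscaleAl B_vert scalerA mulVf // scale1r scaler_sumr.
  by congr (_ + _); apply: eq_bigr => i /negPf ->; rewrite lscaleAl.
Qed.

(* If some coefficient of maximal total degree were a nonzero constant, B would not
   be reduced; otherwise the last ghost edge can be cancelled and D lowered. *)
Lemma reduced_step D (r : I -> L) :
  (forall i, r i * lvert K (v i) = r i) ->
  (forall i, d i = 0%N -> r i = 0) ->
  (forall i, gpoly (D.+1 - d i) (r i)) ->
  (forall b, gpoly D.-1 (\sum_i r i * B i b)) ->
  forall i, gpoly (D - d i) (r i).
Proof.
elim: D r => [|D IH] r rv r0 rD rB.
  move=> i; case: (posnP (d i)) => [/r0 ->|di]; first exact: gpoly0.
  have := rD i; have -> : (1 - d i = 0)%N by lia.
  by move=> ->; apply: gpoly0.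
have rtop := reduced_top rv rD rB.
(* Coefficients that must vanish get the decomposition 0, which guards against truncated subtraction
   in the bounds; tails are cut by [v i] on the right to remain coefficients of [B i]. *)
have dec i : exists c : K * (edge E -> L),
  [/\ r i = c.1 *: lvert K (v i) + \sum_e lghost K e * c.2 e,
      forall e, gpoly (D.+1 - d i) (c.2 e),
      forall e, lvert K (src e) * c.2 e = c.2 e,
      forall e, c.2 e * lvert K (v i) = c.2 e &
      ((d i == 0%N) || (D < d i)%N -> c = (0, fun _ => 0))].
  case: (boolP ((d i == 0%N) || (D < d i)%N)) => [di|].
    exists (0, fun _ => 0); split=> //= [|e|e|e]; rewrite ?mulr0 ?mul0r //.
      rewrite scale0r add0r big1 => [|e _]; last by rewrite mulr0.
      case/orP: di => [/eqP/r0 //|]; rewrite leq_eqVlt => /orP[/eqP/esym/rtop //|di].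
      by have := rD i; have -> : (D.+2 - d i = 0)%N by lia.
    exact: gpoly0.
  rewrite negb_or -leqNgt => /andP[_ di].
  have := rD i; rewrite subSn; last by lia.
  move=> [k [y [yD ys ri]]].
  exists (k (v i), fun e => y e * lvert K (v i)); split=> //= [|e|e|e].
  - rewrite -[LHS]rv ri mulrDl !mulr_suml; congr (_ + _); last first.
      by apply: eq_bigr => e _; rewrite mulrA.
    rewrite (bigD1 (v i)) //= -lscaleAl lvertMid big1 ?addr0 // => w /negPf wv.
    by rewrite -lscaleAl lvertM wv scaler0.
  - have := gpolyM_pred (yD e) (gpoly_vert K (v i)).
    by rewrite addn1.
  - by rewrite mulrA ys.
  - by rewrite -mulrA lvertMid.
have /choice[c c_dec] := dec.
(* The tails behind a fixed leading edge satisfy the hypotheses one degree lower: nonzero constant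
   parts occur only where [d i <= D], so removing them respects the bound. *)
have yD e i : gpoly (D - d i) ((c i).2 e).
  apply: (IH (fun i => (c i).2 e)) => {i} [i|i di|i|b].
  - by have [] := c_dec i.
  - by have [_ _ _ _ ->] := c_dec i; rewrite ?di.
  - by have [] := c_dec i.
  - pose n := (D.+1 + \max_i d i)%N.
    apply: (@ghost_sum_gpoly n D (fun e => \sum_i (c i).2 e * B i b)) => [f|f|].
    + apply: gpoly_sum => i _; have [_ cD _ _ _] := c_dec i.
      apply: gpoly_le (gpolyM_pred (cD f) (B_gpoly i b)).
      by rewrite /n; have := @leq_bigmax _ d i; lia.
    + rewrite mulr_sumr; apply: eq_bigr => i _; rewrite mulrA.
      by have [_ _ -> _ _] := c_dec i.
    + have -> : \sum_f lghost K f * (\sum_i (c i).2 f * B i b) =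
                \sum_i r i * B i b - \sum_i (c i).1 *: B i b.
        rewrite -sumrB; under eq_bigr do rewrite mulr_sumr.
        rewrite exchange_big; apply: eq_bigr => i _ /=.
        have [-> _ _ _ _] := c_dec i.
        rewrite mulrDl -lscaleAl B_vert addrAC subrr add0r mulr_suml.
        by apply: eq_bigr => f _; rewrite mulrA.
      apply: gpolyD; first exact: rB.
      apply/gpolyN/gpoly_sum => i _.
      case: (leqP (d i) D) => di; first exact/gpolyZ/(gpoly_le di).
      by have [_ _ _ _ ->] := c_dec i; rewrite ?di ?orbT // scale0r; apply: gpoly0.
move=> i; have [-> _ _ _ c0] := c_dec i.
case: (leqP (d i) D) => di; last first.
  rewrite c0 ?di ?orbT //= scale0r add0r big1 => [|e _]; last by rewrite mulr0.
  exact: gpoly0.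
rewrite subSn //; apply: gpolyD; first exact/gpolyZ/(@gpoly_le _ _ 1)/gpoly_vert.
by apply: gpoly_sum => e _; apply: gpoly_ghostM.
Qed.

(** The zero sum satisfies every bound, so [reduced_step] can be iterated from a trivially valid [D]
    down to one that forces the coefficient to be 0. *)
Lemma reduced_gpoly_free n (r : I -> L) :
  (forall i, r i * lvert K (v i) = r i) -> (forall i, d i = 0%N -> r i = 0) ->
  (forall i, gpoly n (r i)) -> (forall b, \sum_i r i * B i b = 0) ->
  forall i, r i = 0.
Proof.
move=> rv r0 rn rB.
suff rD D i : gpoly (D - d i) (r i) by move=> i; have := rD (d i) i; rewrite subnn.
have [k] : exists k, (n + \max_i d i <= D + k)%N by exists (n + \max_i d i)%N; lia.
elim: k D i => [|k IH] D i Dk.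
  apply: gpoly_le (rn i); have := @leq_bigmax _ d i; lia.
apply: reduced_step => // [j|b]; last by rewrite rB; apply: gpoly0.
by apply: IH; lia.
Qed.

(** Independence over R extends to L: ghost edges applied on the left turn the coefficients into
    ghost polynomials, and [lghost_inj] carries the vanishing back. *)
Lemma reduced_free (r : I -> L) :
  (forall i, r i * lvert K (v i) = r i) -> (forall i, d i = 0%N -> r i = 0) ->
  (forall b, \sum_i r i * B i b = 0) ->
  forall i, r i = 0.
Proof.
move=> rv r0 rB.
have [N rN] : exists N, forall i, tame N (r i).
  have /choice[N rN] i := tame_ex (r i).
  by exists (\max_i N i) => i; apply: tame_le (rN i); apply: leq_bigmax.
elim: N r rv r0 rB rN => [|N IH] r rv r0 rB rN.
  have /choice[n rn] := rN.
  apply: (@reduced_gpoly_free (\max_i n i)) => // i.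
  by apply: gpoly_le (rn i); apply: leq_bigmax.
move=> i; apply: (lghost_inj no_sink) => e.
apply: (IH (fun i => lghost K e * r i)) => {i} [i|i di|b|i].
- by rewrite -mulrA rv.
- by rewrite r0 // mulr0.
- by under eq_bigr do rewrite -mulrA; rewrite -mulr_sumr rB mulr0.
- exact: rN.
Qed.

End Family.

(** * Splitting idempotent matrices *)

Section Split.
Variables (J : finType) (e : J -> J -> L).

(** The rows of [B] have entries in R and generate the row module of [e]: [e] fixes them, and [X]
    expresses the rows of [e] through them. *)
Definition presents (I : finType) (v : I -> vertex E) (d : I -> nat)
    (X : J -> I -> L) (B : I -> J -> L) :=
  [/\ forall i b, gpoly (d i) (B i b), forall i b, lvert K (v i) * B i b = B i b,
      forall i b, \sum_a B i a * e a b = B i b &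
      forall a b, \sum_i X a i * B i b = e a b].

(** A failure of reducedness is an elementary row operation lowering the total degree; the inverse
    column operation on [X] preserves [X B = e]. *)
Lemma reduce_presents (I : finType) v d X B : @presents I v d X B ->
  exists d' X' B', @presents I v d' X' B' /\ reduced d' B'.
Proof.
have [n] := ubnP (\sum_i d i)%N; elim: n d X B => // n IH d X B dn pB.
case: (pselect (reduced d B)) => [|/existsNP[j]]; first by exists d, X, B.
move=> /not_implyP[dj /contrapT[s [sj sd sB]]].
have [Bd Bv Be XB] := pB.
(* Cutting by vertices keeps the modified row [j] over [v j]. *)
pose t i := lvert K (v j) * s i * lvert K (v i).
have tj : t j = 0 by rewrite /t sj mulr0 mul0r.
have tB i b : t i * B i b = lvert K (v j) * (s i * B i b).
  by rewrite /t -mulrA Bv mulrA.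
pose B' i b := if i == j then B j b + \sum_k t k * B k b else B i b.
apply: (IH (fun i => if i == j then (d j).-1 else d i)
  (fun a i => X a i - X a j * t i) B').
  apply: leq_trans (dn : (\sum_i d i <= n)%N).
  rewrite (bigD1 j) //= [X in (_ < X)%N](bigD1 j) //= eqxx.
  rewrite -addSn prednK //  leq_add2l; apply: leq_sum => i /negPf -> //.
split=> [i b|i b|i b|a b]; rewrite /B'.
- case: eqP => // _.
  have -> : B j b + \sum_k t k * B k b = lvert K (v j) * (B j b + \sum_k s k * B k b).
    rewrite mulrDr Bv mulr_sumr; congr (_ + _); apply: eq_bigr => k _; exact: tB.
  exact: gpoly_vertM.
- case: eqP => // ->; rewrite mulrDr Bv mulr_sumr; congr (_ + _).
  by apply: eq_bigr => k _; rewrite tB mulrA lvertMid.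
- case: eqP => _; last exact: Be.
  under eq_bigr do rewrite mulrDl mulr_suml.
  rewrite big_split /= Be exchange_big; congr (_ + _); apply: eq_bigr => k _ /=.
  by rewrite -[in RHS]Be mulr_sumr; apply: eq_bigr => a _; rewrite mulrA.
- rewrite -XB (bigD1 j) //= eqxx tj mulr0 subr0 [in RHS](bigD1 j) //=.
  rewrite mulrDr -addrA; congr (_ + _).
  rewrite (bigD1 j) //= tj mul0r add0r mulr_sumr -big_split /=.
  apply: eq_bigr => i /negPf ij; rewrite ij mulrBl mulrA addrC subrK //.
Qed.

Definition overt (o : option (vertex E)) : L := if o is Some v then lvert K v else 0.

Definition ediag (I : finType) (o : I -> option (vertex E)) (i k : I) : L :=
  if i == k then overt (o i) else 0.

(** From [B X B = B e = B], the rows of [B X - ediag] are relations among the rows of [B], and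
    freeness makes them 0. A row of degree 0 is zero and gets the label [None]. *)
Lemma presents_split (I : finType) v d X B : @presents I v d X B ->
  exists (o : I -> option (vertex E)) X' Y',
    (forall a b, \sum_i X' a i * Y' i b = e a b) /\
    (forall i k, \sum_a Y' i a * X' a k = ediag o i k).
Proof.
move=> /reduce_presents[d' [X' [B' [[Bd Bv Be XB] B_red]]]].
pose o i := if d' i == 0%N then None else Some (v i).
have oB i b : overt (o i) * B' i b = B' i b.
  rewrite /o; case: eqP => [di|_] /=; last exact: Bv.
  by have := Bd i b; rewrite di mul0r.
have oo i : overt (o i) * overt (o i) = overt (o i).
  by case: (o i) => [w|] /=; [apply: lvertMid | rewrite mul0r].
have ov i : overt (o i) * lvert K (v i) = overt (o i).
  by rewrite /o; case: eqP => _ /=; [rewrite mul0r | apply: lvertMid].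
exists o, (fun a i => X' a i * overt (o i)), B'; split=> [a b|i k].
  by rewrite -XB; apply: eq_bigr => i _; rewrite -mulrA oB.
pose r k := \sum_a B' i a * (X' a k * overt (o k)) - ediag o i k.
suff /(_ k)/eqP : forall k, r k = 0 by rewrite subr_eq0 => /eqP.
apply: (reduced_free Bd Bv B_red) => {k} [k|k dk|b]; rewrite /r.
- rewrite mulrBl mulr_suml /ediag; congr (_ - _).
    by apply: eq_bigr => a _; rewrite -!mulrA ov.
  by case: eqP => [->|_]; rewrite ?ov ?mul0r.
- have ok : overt (o k) = 0 by rewrite /o dk.
  rewrite big1 ?sub0r => [|a _]; last by rewrite ok !mulr0.
  by rewrite /ediag; case: eqP => [->|_]; rewrite ?ok oppr0.
- under eq_bigr do rewrite mulrBl mulr_suml.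
  rewrite sumrB [X in _ - X](bigD1 i) //= /ediag eqxx oB.
  rewrite [X in _ - (_ + X)]big1 ?addr0 => [|k]; last first.
    by rewrite eq_sym => /negPf ->; rewrite mul0r.
  rewrite exchange_big /= -[X in _ - X]Be; apply/eqP; rewrite subr_eq0; apply/eqP.
  apply: eq_bigr => a _; rewrite -XB mulr_sumr; apply: eq_bigr => k _.
  by rewrite -!mulrA oB.
Qed.

End Split.

(** Multiplying rows by ghost edges lowers tameness until all entries lie in R; [sum_real_ghost]
    undoes this with real edges. *)
Lemma exists_gpoly_rows (A J : finType) (B : A -> J -> L) :
  exists (I : finType) (v : I -> vertex E) (d : I -> nat)
         (U : A -> I -> L) (T : I -> A -> L) (W : I -> J -> L),
  [/\ forall i b, gpoly (d i) (W i b), forall i b, lvert K (v i) * W i b = W i b,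
      forall a b, \sum_i U a i * W i b = B a b &
      forall i b, \sum_a T i a * B a b = W i b].
Proof.
have [N BN] : exists N, forall a b, tame N (B a b).
  have /choice[N BN] (x : A * J) := tame_ex (B x.1 x.2).
  exists (\max_x N x) => a b.
  by apply: tame_le (BN (a, b)); apply: (leq_bigmax (a, b)).
elim: N A B BN => [|N IH] A B BN.
  have /choice[n Bn] (x : A * J) := BN x.1 x.2.
  (* Each row is cut by all vertices, so that every generator lies over a single one. *)
  exists (A * vertex E)%type, snd, (fun _ => \max_x n x),
    (fun a x => (a == x.1)%:R), (fun x a => if a == x.1 then lvert K x.2 else 0),
    (fun x b => lvert K x.2 * B x.1 b); split=> [[a w] b|[a w] b|a b|[a w] b] /=.
  - apply: gpoly_vertM; apply: gpoly_le (Bn (a, b)).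
    exact: (leq_bigmax (a, b)).
  - by rewrite mulrA lvertMid.
  - rewrite -(pair_bigA _ (fun a' w => (a == a')%:R * (lvert K w * B a' b))) /=.
    rewrite (bigD1 a) //= eqxx [X in _ + X]big1 ?addr0 => [|a' /negPf aa]; last first.
      by apply: big1 => w _; rewrite eq_sym aa mul0r.
    under eq_bigr do rewrite mul1r.
    by rewrite -mulr_suml sum_lvert mul1r.
  - rewrite (bigD1 a) //= eqxx big1 ?addr0 // => a' /negPf ->.
    by rewrite mul0r.
have [|I [v [d [U [T [W [Wd Wv UW TW]]]]]]] :=
    IH (A * edge E)%type (fun x b => lghost K x.2 * B x.1 b).
  by move=> [a e] b; apply: BN.
exists I, v, d, (fun a i => \sum_e lreal K e * U (a, e) i),
  (fun i a => \sum_e T i (a, e) * lghost K e), W; split=> // [a b|i b].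
  under eq_bigr do rewrite mulr_suml.
  rewrite exchange_big /= -[RHS]mul1r -(sum_real_ghost K no_sink) mulr_suml.
  apply: eq_bigr => e _; under eq_bigr do rewrite -mulrA.
  by rewrite -mulr_sumr UW mulrA.
rewrite -TW; transitivity (\sum_a \sum_e T i (a, e) * (lghost K e * B a b)).
  by apply: eq_bigr => a _; rewrite mulr_suml; apply: eq_bigr => e _; rewrite mulrA.
by rewrite pair_bigA; apply: eq_bigr => -[].
Qed.

Lemma idempotent_split (J : finType) (e : J -> J -> L) :
  (forall a b, \sum_c e a c * e c b = e a b) ->
  exists (I : finType) (o : I -> option (vertex E)) X Y,
    (forall a b, \sum_i X a i * Y i b = e a b) /\
    (forall i k : I, \sum_a Y i a * X a k = ediag o i k).
Proof.
move=> ee; have [I [v [d [U [T [W [Wd Wv UW TW]]]]]]] := exists_gpoly_rows e.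
exists I; apply: (@presents_split J e I v d U W); split=> // i b.
under eq_bigr do rewrite -TW mulr_suml.
rewrite exchange_big -[in RHS]TW; apply: eq_bigr => a _ /=.
by under eq_bigr do rewrite -mulrA; rewrite -mulr_sumr ee.
Qed.

End WeakReduction.

(** * Dimension vectors of subquotients *)

Section GradedBases.
Variables (K : fieldType) (E : digraph) (Z : lmodType K).
Local Notation V := (vertex E).

(* A vector labelled Some v lies over the vertex v; vectors labelled None are
   ignored. *)
Definition count_label (N : finType) (l : N -> option V) (w : V) : nat :=
  #|[pred i | l i == Some w]|.

Definition graded_sub (A : V -> Z -> Prop) :=
  forall v, A v 0 /\ forall a x y, A v x -> A v y -> A v (a *: x + y).

Section SubTheory.
Variables (A : V -> Z -> Prop) (sA : graded_sub A).

Lemma gsub0 v : A v 0. Proof. by have [] := sA v. Qed.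
Lemma gsubZ v a x : A v x -> A v (a *: x).
Proof. by move=> Ax; rewrite -[_ *: _]addr0; have [A0] := sA v; apply. Qed.
Lemma gsubD v x y : A v x -> A v y -> A v (x + y).
Proof. by move=> Ax Ay; rewrite -[x]scale1r; have [_] := sA v; apply. Qed.
Lemma gsubN v x : A v x -> A v (- x).
Proof. by rewrite -scaleN1r; apply: gsubZ. Qed.
Lemma gsubB v x y : A v x -> A v y -> A v (x - y).
Proof. by move=> Ax /gsubN; apply: gsubD. Qed.
Lemma gsub_sum v (I : finType) (P : pred I) (F : I -> Z) :
  (forall i, P i -> A v (F i)) -> A v (\sum_(i | P i) F i).
Proof. by move=> AF; apply: (big_ind (A v)); [exact: gsub0 | exact: gsubD | ]. Qed.
End SubTheory.

(** Together with [free_mod]: the vectors labelled [v] form a basis of [A v] modulo [B v]. *)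
Definition spans_mod (A B : V -> Z -> Prop) (N : finType) (l : N -> option V)
    (u : N -> Z) :=
  (forall i v, l i = Some v -> A v (u i)) /\
  (forall v x, A v x ->
    exists k : N -> K, B v (x - \sum_(i | l i == Some v) k i *: u i)).

Definition free_mod (B : V -> Z -> Prop) (N : finType) (l : N -> option V)
    (u : N -> Z) :=
  forall v (k : N -> K), B v (\sum_(i | l i == Some v) k i *: u i) ->
  forall i, l i = Some v -> k i = 0.

(** Steinitz: otherwise the matrix expressing the free vectors through the spanning ones has a
    nonzero left kernel vector, which is a forbidden relation modulo [B]. *)
Lemma free_le_spans A B (sB : graded_sub B) (N M : finType) l u l' u' :
  (forall (i : N) v, l i = Some v -> A v (u i)) ->
  free_mod B l u -> @spans_mod A B M l' u' ->
  forall w, (count_label l w <= count_label l' w)%N.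
Proof.
move=> Au fu [_ su] w; rewrite leqNgt; apply/negP => lt_ll.
pose P := [pred i | l i == Some w]; pose P' := [pred i | l' i == Some w].
have /choice[c cP] i : exists k : M -> K,
    P i -> B w (u i - \sum_(j | P' j) k j *: u' j).
  case: (boolP (P i)) => [/eqP Pi|_]; last by exists (fun _ => 0).
  by have [k] := su w (u i) (Au _ _ Pi); exists k.
pose C : 'M[K]_(#|P|, #|P'|) := \matrix_(i, j) c (enum_val i) (enum_val j).
have [r rC rC0] : exists2 r : 'rV_#|P|, r != 0 & r *m C = 0.
  have : kermx C != 0.
    rewrite -mxrank_eq0 mxrank_ker subn_eq0 -ltnNge.
    by apply: leq_ltn_trans lt_ll; apply: rank_leq_col.
  by case/rowV0Pn => r /sub_kermxP rC r0; exists r.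
case/eqP: rC; apply/rowP => x; rewrite mxE.
(* The kernel vector, extended by zero to all of [N]. *)
pose k i := \sum_(y < #|P|) if enum_val y == i then r 0 y else 0.
have kE y : k (enum_val y) = r 0 y.
  rewrite /k (bigD1 y) //= eqxx big1 ?addr0 // => z /negPf zy.
  by rewrite (inj_eq enum_val_inj) zy.
have Px : P (enum_val x) := enum_valP x.
rewrite -kE; apply: (fu w) (eqP Px).
have -> : \sum_(i | l i == Some w) k i *: u i =
          \sum_(i | P i) k i *: (u i - \sum_(j | P' j) c i j *: u' j).
  apply/eqP; rewrite -subr_eq0 -sumrB; apply/eqP.
  under eq_bigr do rewrite scalerBr opprB addrC subrK scaler_sumr.
  rewrite exchange_big /= [LHS]big_enum_val /=; apply: big1 => j _.
  under eq_bigr do rewrite scalerA.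
  rewrite -scaler_suml (big_enum_val (A := P)) /=.
  under eq_bigr do rewrite kE.
  have /rowP/(_ j) := rC0; rewrite !mxE => rC0j.
  transitivity ((\sum_y r 0 y * C y j) *: u' (enum_val j)); last by rewrite rC0j scale0r.
  congr (_ *: _).
  by apply: eq_bigr => y _; rewrite mxE.
apply: gsub_sum => // i Pi; apply: gsubZ => //; exact: cP.
Qed.

Lemma count_label_basis A B (sB : graded_sub B) (N M : finType) l u l' u' :
  @spans_mod A B N l u -> free_mod B l u ->
  @spans_mod A B M l' u' -> free_mod B l' u' ->
  forall w, count_label l w = count_label l' w.
Proof.
move=> su fu su' fu' w; apply/eqP; rewrite eqn_leq; apply/andP; split.
  exact: (free_le_spans sB su.1 fu su').
exact: (free_le_spans sB su'.1 fu' su).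
Qed.

(* Redundant generators are discarded by replacing their label with None. *)
Lemma spans_free A B (sB : graded_sub B) (N : finType) l u :
  @spans_mod A B N l u ->
  exists l' : N -> option V, spans_mod A B l' u /\ free_mod B l' u.
Proof.
have [n] := ubnP #|[pred i | l i != None]|; elim: n l => // n IH l ln su.
case: (pselect (free_mod B l u)) => [|/existsNP[v /existsNP[k]]]; first by exists l.
move=> /not_implyP[Bk /existsNP[j /not_implyP[lj /eqP kj]]].
apply: (IH (fun i => if i == j then None else l i)).
  apply: leq_trans (ln : _ <= n)%N; apply: proper_card; apply/properP; split.
    by apply/subsetP => i; rewrite !inE; case: (i == j).
  by exists j; rewrite !inE ?lj // eqxx.
have [Au su'] := su; split=> [i w|w x Ax]; first by case: eqP => // _; apply: Au.
have [c Bc] := su' w x Ax.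
have filt (F : N -> Z) : \sum_(i | (if i == j then None else l i) == Some w) F i =
    \sum_(i | (l i == Some w) && (i != j)) F i.
  by apply: eq_bigl => i; case: (i == j); rewrite ?andbF ?andbT.
case: (eqVneq w v) => [wv|wv]; last first.
  exists c; rewrite filt; congr (B w (x - _)): Bc; apply: eq_bigl => i.
  case: (eqVneq i j) => [->|_]; rewrite ?andbT ?andbF // lj.
  by apply/negP => /eqP[vw]; rewrite vw eqxx in wv.
(* Subtracting [c j / k j] times the relation [k] clears the coefficient at [j]. *)
exists (fun i => c i - c j / k j * k i); rewrite filt.
move: Bc Bk; rewrite wv (bigD1 j) ?lj //= [X in _ -> B v X -> _](bigD1 j) ?lj //=.
move=> Bc Bk.
have -> : x - \sum_(i | (l i == Some v) && (i != j)) (c i - c j / k j * k i) *: u i =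
   (x - (c j *: u j + \sum_(i | (l i == Some v) && (i != j)) c i *: u i)) +
   (c j / k j) *: (k j *: u j + \sum_(i | (l i == Some v) && (i != j)) k i *: u i).
  under eq_bigr do rewrite scalerBl -scalerA.
  rewrite sumrB -scaler_sumr scalerDr scalerA divfK // opprB opprD.
  by rewrite -[RHS]addrA addrACA addNr add0r; congr (_ + _); rewrite addrC.
by apply: gsubD => //; apply: gsubZ.
Qed.

Definition cat_label (N M : Type) (l : N -> option V) (l' : M -> option V)
    (i : N + M) := match i with inl i => l i | inr j => l' j end.
Definition cat_vec (N M : Type) (u : N -> Z) (u' : M -> Z) (i : N + M) :=
  match i with inl i => u i | inr j => u' j end.

Lemma count_label_cat (N M : finType) l l' w :
  count_label (@cat_label N M l l') w = (count_label l w + count_label l' w)%N.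
Proof. by rewrite /count_label -!sum1_card big_sumType. Qed.

(** With [free_cat], this makes dimension vectors additive along a filtration. *)
Lemma spans_cat (A B C : V -> Z -> Prop) (N M : finType) l u l' u' :
  (forall v x, B v x -> A v x) ->
  @spans_mod A B N l u -> @spans_mod B C M l' u' ->
  spans_mod A C (cat_label l l') (cat_vec u u').
Proof.
move=> BA [Au su] [Bu su']; split=> [[i|j] v /=|v x Ax]; first exact: Au.
  by move/Bu/BA.
have [k Bk] := su v x Ax; have [k' Ck] := su' v _ Bk.
exists (fun i => match i with inl i => k i | inr j => k' j end).
by rewrite big_sumType /= opprD addrA.
Qed.

Lemma free_cat (B C : V -> Z -> Prop) (sB : graded_sub B) (sC : graded_sub C)
    (N M : finType) l u l' u' :
  (forall v x, C v x -> B v x) ->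
  @free_mod B N l u -> @spans_mod B C M l' u' -> free_mod C l' u' ->
  @free_mod C (N + M)%type (cat_label l l') (cat_vec u u').
Proof.
move=> CB fu [Bu _] fu' v k; rewrite big_sumType /= => Ck.
have k0 : forall i, l i = Some v -> k (inl i) = 0.
  apply: fu; rewrite -[X in B v X](addrK (\sum_(j | l' j == Some v) k (inr j) *: u' j)).
  apply: gsubB => //; first exact: CB.
  by apply: gsub_sum => // j /eqP lj; apply: gsubZ => //; apply: Bu.
case=> [i|j]; first exact: k0.
apply: (fu' v (fun j => k (inr j))); move: Ck; rewrite big1 ?add0r // => i /eqP li.
by rewrite k0 ?scale0r.
Qed.

Section Shift.
Variable g : edge E -> {linear Z -> Z}.

(* The graded subspace J A, where g e is the action of the ghost edge e. *)
Definition shift (A : V -> Z -> Prop) (w : V) (x : Z) :=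
  exists2 y : edge E -> Z, forall e, A (src e) (y e) &
    x = \sum_(e | w == tgt e) g e (y e).

Lemma shift_sub A : graded_sub A -> graded_sub (shift A).
Proof.
move=> sA v; split.
  by exists (fun _ => 0) => [e|]; [exact: gsub0 | rewrite big1 // => e _; rewrite linear0].
move=> a x y [x' Ax ->] [y' Ay ->]; exists (fun e => a *: x' e + y' e) => [e|].
  by apply: gsubD => //; apply: gsubZ.
by rewrite scaler_sumr -big_split; apply: eq_bigr => e _; rewrite linearP.
Qed.

Lemma shift_mono A B : (forall v x, A v x -> B v x) ->
  forall v x, shift A v x -> shift B v x.
Proof. by move=> AB v x [y Ay ->]; exists y => // e; apply: AB. Qed.

Definition shift_label (N : finType) (l : N -> option V) (p : edge E * N) :=
  if l p.2 == Some (src p.1) then Some (tgt p.1) else None.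
Definition shift_vec (N : finType) (u : N -> Z) (p : edge E * N) := g p.1 (u p.2).

Lemma shift_label_sum (W : nmodType) (N : finType) (l : N -> option V) w
    (F : edge E * N -> W) :
  \sum_(p | shift_label l p == Some w) F p =
  \sum_(e | w == tgt e) \sum_(i | l i == Some (src e)) F (e, i).
Proof.
rewrite pair_big_dep /=; apply: eq_big; last by case.
case=> e i /=.
rewrite /shift_label /=; case: (l i == Some (src e)); rewrite ?andbF ?andbT //=.
by apply/eqP/eqP => [[->]|->].
Qed.

(** On dimension vectors, [shift] acts as the transposed incidence matrix. *)
Lemma count_label_shift (N : finType) (l : N -> option V) w :
  count_label (shift_label l) w = (\sum_(e | w == tgt e) count_label l (src e))%N.
Proof.
rewrite /count_label -sum1_card shift_label_sum.
by apply: eq_bigr => e _; rewrite sum1_card.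
Qed.

Lemma spans_shift A B (N : finType) l u :
  graded_sub A -> @spans_mod A B N l u ->
  spans_mod (shift A) (shift B) (shift_label l) (shift_vec u).
Proof.
move=> sA [Au su]; split=> [[e i] v|v x [y Ay ->]].
  rewrite /shift_label /=; case: eqP => // li [<-].
  exists (fun f => if f == e then u i else 0) => [f|].
    by case: eqP => [->|_]; [apply: Au | apply: gsub0].
  rewrite (bigD1 e) //= eqxx big1 ?addr0 // => f /andP[_ /negPf ->].
  by rewrite linear0.
have /choice[k kB] e := su _ _ (Ay e).
exists (fun p => k p.1 p.2).
exists (fun e => y e - \sum_(i | l i == Some (src e)) k e i *: u i) => //.
rewrite shift_label_sum -sumrB; apply: eq_bigr => e _.
rewrite /= [RHS]linearB [X in _ = _ - X]linear_sum; congr (_ - _).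
apply: eq_bigr => i _.
by rewrite /shift_vec linearZ.
Qed.

(** As the edges act jointly injectively on [A], the quotient of [shift A] by [shift B] over [w] is
    the direct sum, over the edges into [w], of [A] modulo [B] at their sources. *)
Lemma free_shift A B (N : finType) l u :
  graded_sub A -> graded_sub B -> (forall v x, B v x -> A v x) ->
  (forall w (y : edge E -> Z), (forall e, A (src e) (y e)) ->
     \sum_(e | w == tgt e) g e (y e) = 0 -> forall e, w = tgt e -> y e = 0) ->
  (forall i v, l i = Some v -> A v (u i)) -> @free_mod B N l u ->
  free_mod (shift B) (shift_label l) (shift_vec u).
Proof.
move=> sA sB BA inj Au fu w k [b Bb kb] [e i].
rewrite /shift_label /=; case: eqP => // li [te].
pose y f := \sum_(i | l i == Some (src f)) k (f, i) *: u i - b f.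
have y0 : y e = 0.
  apply: (inj w y) => // [f|].
    apply: gsubB => //; last exact: BA.
    by apply: gsub_sum => // j /eqP lj; apply: gsubZ => //; apply: Au.
  under eq_bigr do rewrite linearB linear_sum.
  rewrite sumrB -kb shift_label_sum; apply/eqP; rewrite subr_eq0; apply/eqP.
  by apply: eq_bigr => f _; apply: eq_bigr => j _; rewrite linearZ.
apply: (fu (src e) (fun i => k (e, i))) li.
by move/eqP: y0; rewrite subr_eq0 => /eqP ->.
Qed.

End Shift.

End GradedBases.

(** * Comparison of free modules *)

Section LatticeComparison.
Variables (K : fieldType) (E : digraph).
Local Notation L := (leavitt K E).
Local Notation V := (vertex E).
Local Notation ov := (@overt K E).
Hypothesis no_sink : forall v : vertex E, exists e : edge E, src e = v.

Definition ghost_mul (J : finType) (e : edge E) (x : {ffun J -> L}) : {ffun J -> L} :=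
  [ffun j => lghost K e * x j].

Fact ghost_mul_linear J e : linear (@ghost_mul J e).
Proof.
move=> a x y; apply/ffunP => j; rewrite !ffunE mulrDr lscaleAr //.
Qed.
HB.instance Definition _ J e :=
  GRing.isLinear.Build K _ _ _ (@ghost_mul J e) (ghost_mul_linear e).

Definition gm (J : finType) (e : edge E) : {linear {ffun J -> L} -> {ffun J -> L}} :=
  @ghost_mul J e.

Lemma gmE (J : finType) e (x : {ffun J -> L}) j : gm J e x j = lghost K e * x j.
Proof. exact: ffunE. Qed.


Lemma overtMid o : ov o * ov o = ov o.
Proof. by case: o => [v|] /=; [apply: lvertMid | rewrite mul0r]. Qed.

Lemma lvert_overt w o : lvert K w * ov o = if o == Some w then ov o else 0.
Proof.
case: o => [v|] /=; last by rewrite mulr0.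
rewrite lvertM eq_sym; case: eqVneq => [->|vw]; rewrite ?eqxx //.
by case: eqP => // -[/eqP]; rewrite (negPf vw).
Qed.

Lemma tame_overt o : tame 0 (ov o).
Proof. by case: o => [v|]; [exists 1%N; apply: gpoly_vert | exists 0%N]. Qed.

(* The part over w of the free R-module with one generator of type o j for each j. *)
Definition row_mod (J : finType) (o : J -> option V) (w : V) (x : {ffun J -> L}) :=
  forall j, [/\ tame 0 (x j), x j * ov (o j) = x j & lvert K w * x j = x j].

Definition row_unit (J : finType) (o : J -> option V) (j : J) : {ffun J -> L} :=
  [ffun b => if b == j then ov (o j) else 0].

Lemma row_mod_sub (J : finType) o : graded_sub (@row_mod J o).
Proof.
move=> v; split=> [j|a x y xP yP j].
  by rewrite !ffunE mulr0 mul0r; split=> //; exists 0%N.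
have [xt xo xv] := xP j; have [yt yo yv] := yP j; rewrite !ffunE; split.
- by apply: tameD => //; apply: tameZ.
- by rewrite mulrDl -lscaleAl xo yo.
- by rewrite mulrDr -lscaleAr xv yv.
Qed.

Lemma shift_row_mod J o w x :
  shift (gm J) (@row_mod J o) w x -> row_mod o w x.
Proof.
move=> [y yP ->]; apply: gsub_sum => [|e /eqP ->]; first exact: row_mod_sub.
move=> j; have [yt yo yv] := yP e j; rewrite gmE; split.
- by apply: tame_ghostM.
- by rewrite -mulrA yo.
- by rewrite mulrA tgt_lghost.
Qed.

Lemma ghost_row_inj (J : finType) o w (k : K) (y : edge E -> {ffun J -> L}) b :
  (forall e, row_mod o (src e) (y e)) ->
  k *: lvert K w = \sum_(e | w == tgt e) lghost K e * y e b ->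
  k = 0 /\ forall e, w = tgt e -> y e b = 0.
Proof.
move=> yP ky.
have /choice[n yn] e : exists n, gpoly n (y e b) by have [] := yP e b.
have [|||kw yw] := @ghost_comb_inj K E no_sink (\max_e n e)
  (fun v => if v == w then k else 0) (fun e => if w == tgt e then - y e b else 0).
- move=> e; case: ifP => _; last exact: gpoly0.
  by apply/gpolyN/(gpoly_le _ (yn e)); apply: leq_bigmax.
- move=> e; case: ifP => _; last exact: mulr0.
  by rewrite mulrN; have [_ _ ->] := yP e b.
- rewrite /ghost_comb (bigD1 w) //= eqxx [X in _ + X + _]big1 => [|v /negPf ->]; last first.
    by rewrite scale0r.
  rewrite addr0 ky big_mkcond -big_split big1 //= => e _.
  by case: ifP => _; rewrite ?mulr0 ?addr0 // mulrN subrr.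
split; first by have := kw w; rewrite eqxx.
by move=> e we; have := yw e; rewrite we eqxx => /eqP; rewrite oppr_eq0 => /eqP.
Qed.

Lemma ghost_mul_inj (J : finType) o w (y : edge E -> {ffun J -> L}) :
  (forall e, row_mod o (src e) (y e)) ->
  \sum_(e | w == tgt e) gm J e (y e) = 0 -> forall e, w = tgt e -> y e = 0.
Proof.
move=> yP y0 e we; apply/ffunP => b; rewrite ffunE.
have [||_ ->] := @ghost_row_inj J o w 0 y b => //.
move/ffunP/(_ b): y0; rewrite sum_ffunE scale0r ffunE => y0; rewrite -[LHS]y0.
by apply: eq_bigr => f _; rewrite gmE.
Qed.

Lemma sum_row_unit (J : finType) (o : J -> option V) w (k : J -> K) b :
  (\sum_(j | o j == Some w) k j *: row_unit o j) b =
  if o b == Some w then k b *: lvert K w else 0.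
Proof.
rewrite sum_ffunE; case: eqP => ob.
  rewrite (bigD1 b) ?ob //= !ffunE eqxx ob big1 ?addr0 // => j /andP[_ /negPf jb].
  by rewrite !ffunE eq_sym jb scaler0.
apply: big1 => j /eqP oj; rewrite !ffunE; case: eqP => [bj|_]; last exact: scaler0.
by case: ob; rewrite bj.
Qed.

Lemma row_unit_mod J o j v : o j = Some v -> row_mod o v (@row_unit J o j).
Proof.
move=> oj b; rewrite !ffunE; case: eqP => [->|_]; rewrite ?mul0r ?mulr0.
  by rewrite oj /= lvertMid; split=> //; exists 1%N; apply: gpoly_vert.
by split=> //; exists 0%N.
Qed.

(** Modulo leading ghost edges, only the constant terms of the entries survive. *)
Lemma spans_row_mod J o :
  spans_mod (row_mod o) (shift (gm J) (row_mod o)) o (row_unit o).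
Proof.
split=> [j v|v x xP]; first exact: row_unit_mod.
have /choice[c cP] j : exists c : K * (edge E -> L),
    x j = c.1 *: (lvert K v * ov (o j)) +
          \sum_(e | v == tgt e) lghost K e * c.2 e /\
    forall e, [/\ tame 0 (c.2 e), c.2 e * ov (o j) = c.2 e
                & lvert K (src e) * c.2 e = c.2 e].
  have [[n /gpolyS[k [y [yn ys xj]]]] xo xv] := xP j.
  exists (k v, fun e => y e * ov (o j)); split=> /= [|e].
    rewrite -xo -xv xj lvert_comb mulrDl mulr_suml lscaleAl; congr (_ + _).
    by apply: eq_bigr => e _; rewrite mulrA.
  split; last by rewrite mulrA ys.
    exact: tame_gpolyM (yn e) (tame_overt _).
  by rewrite -mulrA overtMid.
exists (fun j => (c j).1), (fun e => [ffun j => (c j).2 e]) => [e j|].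
  by rewrite ffunE; have [_] := cP j; apply.
apply/ffunP => b; rewrite !ffunE sum_row_unit sum_ffunE.
have [-> _] := cP b; rewrite lvert_overt.
under [RHS]eq_bigr do rewrite gmE ffunE.
case: eqP => [->|_] /=; first by rewrite addrAC subrr add0r.
by rewrite scaler0 add0r subr0.
Qed.

Lemma free_row_mod J o : free_mod (shift (gm J) (row_mod o)) o (row_unit o).
Proof.
move=> v k [y yP ky] j oj.
have [||-> _] := @ghost_row_inj J o v (k j) y j => //.
move/ffunP/(_ j): ky; rewrite sum_row_unit oj eqxx sum_ffunE => ->.
by apply: eq_bigr => f _; rewrite gmE.
Qed.

Lemma iter_shift_mod J o k v x :
  iter k (shift (gm J)) (row_mod o) v x -> row_mod o v x.
Proof.
elim: k v x => [//|k IH] v x /= /(shift_mono IH); exact: shift_row_mod.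
Qed.

(** Powers of J have finite codimension, one layer of the filtration being added at a time. *)
Lemma spans_iter_shift J o k : exists (N : finType) (l : N -> option V) u,
  spans_mod (row_mod o) (iter k (shift (gm J)) (row_mod o)) l u.
Proof.
elim: k => [|k [N [l [u su]]]].
  exists void, (fun _ => None), (fun _ => 0); split=> // v x xP.
  by exists (fun _ => 0); rewrite big1 ?subr0 // => -[].
have := spans_cat (@shift_row_mod J o) (spans_row_mod o)
  (spans_shift (gm J) (row_mod_sub o) su).
by exists (J + edge E * N)%type, (cat_label o (shift_label l)),
  (cat_vec (row_unit o) (shift_vec (gm J) u)).
Qed.

(** * Comparison through a pair of inverse matrices *)

Section Count.
Variables (I J : finType) (o : I -> option V) (o' : J -> option V).
Variables (X : I -> J -> L) (Y : J -> I -> L).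
Hypothesis XY : forall i k, \sum_j X i j * Y j k = ediag K o i k.
Hypothesis YX : forall j b, \sum_i Y j i * X i b = ediag K o' j b.
Hypothesis Xo : forall i j, X i j * ov (o' j) = X i j.
Hypothesis Yo : forall j i, Y j i * ov (o i) = Y j i.
Hypothesis X_tame : forall i j, tame 0 (X i j).

Definition row_mul (r : {ffun I -> L}) : {ffun J -> L} :=
  [ffun j => \sum_i r i * X i j].

Fact row_mul_linear : linear row_mul.
Proof.
move=> a x y; apply/ffunP => j; rewrite !ffunE scaler_sumr -big_split /=.
by apply: eq_bigr => i _; rewrite !ffunE mulrDl lscaleAl.
Qed.
HB.instance Definition _ := GRing.isLinear.Build K _ _ _ row_mul row_mul_linear.

(** The small free module S inside the big one T, embedded by [X], whose entries lie in R; its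
    inverse [Y] has entries in L. *)
Definition row_image (w : V) (x : {ffun J -> L}) :=
  exists2 r, row_mod o w r & x = row_mul r.

Lemma row_image_sub : graded_sub row_image.
Proof.
move=> v; split.
  exists 0; last by rewrite linear0.
  by have [] := row_mod_sub o v.
move=> a x y [r rP ->] [s sP ->]; exists (a *: r + s); last by rewrite linearP.
by have [_] := row_mod_sub o v; apply.
Qed.

Lemma row_image_mod w x : row_image w x -> row_mod o' w x.
Proof.
move=> [r rP ->] j; rewrite ffunE; split.
- apply: tame_sum => i _; have [[n rn] _ _] := rP i; exact: tame_gpolyM rn _.
- by rewrite mulr_suml; apply: eq_bigr => i _; rewrite -mulrA Xo.
- by rewrite mulr_sumr; apply: eq_bigr => i _; rewrite mulrA; have [_ _ ->] := rP i.
Qed.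

Lemma row_mul_inj w r : row_mod o w r -> row_mul r = 0 -> r = 0.
Proof.
move=> rP r0; apply/ffunP => k; rewrite ffunE; have [_ <- _] := rP k.
transitivity (\sum_i r i * ediag K o i k).
  rewrite (bigD1 k) //= /ediag eqxx big1 ?addr0 // => i /negPf ->.
  by rewrite mulr0.
transitivity (\sum_j row_mul r j * Y j k); last first.
  by rewrite r0 big1 // => j _; rewrite ffunE mul0r.
under eq_bigr do rewrite -XY mulr_sumr.
rewrite exchange_big; apply: eq_bigr => j _; rewrite ffunE mulr_suml.
by apply: eq_bigr => i _; rewrite mulrA.
Qed.

Lemma row_mul_ghost e r : row_mul (gm I e r) = gm J e (row_mul r).
Proof.
apply/ffunP => j; rewrite gmE !ffunE mulr_sumr; apply: eq_bigr => i _.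
by rewrite gmE mulrA.
Qed.

Lemma shift_row_image w x : shift (gm J) row_image w x <->
  exists2 r, shift (gm I) (row_mod o) w r & x = row_mul r.
Proof.
split=> [[y yP ->]|[r [y yP ->] ->]].
  have /choice[r rP] e : exists r, row_mod o (src e) r /\ y e = row_mul r.
    by have [r rP ->] := yP e; exists r.
  exists (\sum_(e | w == tgt e) gm I e (r e)).
    by exists r => // e; have [] := rP e.
  rewrite linear_sum; apply: eq_bigr => e _.
  by rewrite [RHS]row_mul_ghost; have [_ ->] := rP e.
exists (fun e => row_mul (y e)) => [e|]; first by exists (y e).
by rewrite linear_sum; apply: eq_bigr => e _; rewrite -[RHS]row_mul_ghost.
Qed.

Lemma spans_row_image :
  spans_mod row_image (shift (gm J) row_image) o (fun i => row_mul (row_unit o i)).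
Proof.
have [ou su] := spans_row_mod o; split=> [i v oi|v x [r rP ->]].
  by exists (row_unit o i) => //; apply: ou.
have [k rk] := su v r rP; exists k; apply/shift_row_image.
exists (r - \sum_(i | o i == Some v) k i *: row_unit o i) => //.
rewrite [RHS]linearB [X in _ = _ - X]linear_sum; congr (_ - _).
by apply: eq_bigr => i _; rewrite linearZ.
Qed.

Lemma free_row_image :
  free_mod (shift (gm J) row_image) o (fun i => row_mul (row_unit o i)).
Proof.
move=> v k /shift_row_image[r rP kr]; apply: free_row_mod.
suff -> : \sum_(i | o i == Some v) k i *: row_unit o i = r by [].
apply/eqP; rewrite -subr_eq0; apply/eqP; apply: (@row_mul_inj v).
  apply: (gsubB (row_mod_sub o)); last exact: shift_row_mod.
  apply: (gsub_sum (row_mod_sub o)) => i /eqP oi.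
  by apply: (gsubZ (row_mod_sub o)); apply: row_unit_mod.
rewrite [LHS]linearB [X in X - _ = _]linear_sum /= -kr; apply/eqP; rewrite subr_eq0; apply/eqP.
by apply: eq_bigr => i _; rewrite linearZ.
Qed.

(** Each leading ghost edge of [x] is spent on lowering the tameness of [Y] by one. *)
Lemma iter_shift_tame M k v x : (forall j i, tame M (Y j i)) ->
  iter k (shift (gm J)) (row_mod o') v x ->
  forall i, tame (M - k) (\sum_j x j * Y j i).
Proof.
move=> YM; elim: k v x => [|k IH] v x.
  move=> xP i; rewrite subn0; apply: tame_sum => j _.
  by have [[n xn] _ _] := xP j; apply: tame_gpolyM xn _.
move=> [y yP ->] i; under eq_bigr do rewrite sum_ffunE mulr_suml.
rewrite exchange_big; apply: tame_sum => e _ /=.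
under eq_bigr do rewrite gmE -mulrA; rewrite -mulr_sumr.
have := IH _ _ (yP e) i; rewrite subnS; case: (M - k)%N => [|m] /=.
  by move=> [n yn]; exists n.+1; apply: gpoly_ghostM.
by apply.
Qed.

(** For long ghost prefixes [x Y] has entries in R, and [x = (x Y) X]; hence S contains a power of J
    times T. *)
Lemma iter_shift_image M k v x : (forall j i, tame M (Y j i)) -> (M <= k)%N ->
  iter k (shift (gm J)) (row_mod o') v x -> row_image v x.
Proof.
move=> YM Mk xk; have xP := iter_shift_mod xk.
exists [ffun i => \sum_j x j * Y j i] => [i|].
  rewrite ffunE; split.
  - by have := iter_shift_tame YM xk i; rewrite (eqP Mk).
  - by rewrite mulr_suml; apply: eq_bigr => j _; rewrite -mulrA Yo.
  - by rewrite mulr_sumr; apply: eq_bigr => j _; rewrite mulrA; have [_ _ ->] := xP j.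
apply/ffunP => b; rewrite ffunE; have [_ <- _] := xP b.
transitivity (\sum_j x j * ediag K o' j b).
  rewrite (bigD1 b) //= /ediag eqxx big1 ?addr0 // => j /negPf ->.
  by rewrite mulr0.
under eq_bigr do rewrite -YX mulr_sumr.
rewrite exchange_big; apply: eq_bigr => i _; rewrite ffunE mulr_suml.
by apply: eq_bigr => j _; rewrite mulrA.
Qed.

(* Both sides are the dimension over w of row_mod o' modulo shift row_image, computed
   through row_image and through shift (row_mod o'). *)
Lemma count_tame : exists q : V -> nat, forall w,
  (q w + count_label o w =
   count_label o' w + \sum_(e | w == tgt e) q (src e))%N.
Proof.
have [M YM] : exists M, forall j i, tame M (Y j i).
  have /choice[M YM] (p : J * I) := tame_ex (Y p.1 p.2).
  exists (\max_p M p) => j i.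
  by apply: tame_le (YM (j, i)); apply: (leq_bigmax (j, i)).
have [N [l0 [u [Au su]]]] := @spans_iter_shift J o' M.
have {}su : spans_mod (row_mod o') row_image l0 u.
  split=> // v x /su[k xk]; exists k; exact: iter_shift_image YM _ xk.
have [l [{}su fu]] := spans_free row_image_sub su.
(* The witness is the dimension vector of T / S. *)
exists (count_label l) => w; rewrite -count_label_shift -!count_label_cat.
have sS := shift_sub (gm J) row_image_sub.
apply: (count_label_basis sS).
- exact: spans_cat row_image_mod su spans_row_image.
- apply: free_cat fu spans_row_image free_row_image => //.
    exact: row_image_sub.
  move=> v x /shift_row_image[r rP ->]; exists r => //; exact: shift_row_mod.
- exact: spans_cat (@shift_row_mod J o') (spans_row_mod o')
    (spans_shift (gm J) (row_mod_sub o') su).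
- apply: free_cat (@free_row_mod J o') (spans_shift (gm J) (row_mod_sub o') su) _ => //.
  + exact/shift_sub/row_mod_sub.
  + exact: shift_mono row_image_mod.
  + apply: free_shift (row_mod_sub o') row_image_sub row_image_mod _ su.1 fu.
    exact: ghost_mul_inj.
Qed.

End Count.

(** Applying ghost edges to the rows of [X] replaces each [L v] by the sum of the [L (tgt e)] over
    the edges leaving [v] and lowers tameness; after [N] rounds [count_tame] applies. *)
Lemma count_equivalent (J : finType) (o' : J -> option V) N (I : finType)
    (o : I -> option V) (X : I -> J -> L) (Y : J -> I -> L) :
  (forall i k, \sum_j X i j * Y j k = ediag K o i k) ->
  (forall j b, \sum_i Y j i * X i b = ediag K o' j b) ->
  (forall i j, ov (o i) * X i j = X i j) -> (forall i j, X i j * ov (o' j) = X i j) ->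
  (forall j i, Y j i * ov (o i) = Y j i) -> (forall i j, tame N (X i j)) ->
  exists q : V -> int, forall w,
    (count_label o w)%:Z = (count_label o' w)%:Z + \sum_(e | w == tgt e) q (src e) - q w.
Proof.
elim: N I o X Y => [|N IH] I o X Y XY YX oX Xo Yo XN.
  have [q qE] := count_tame XY YX Xo Yo XN.
  exists (fun v => (q v)%:Z) => w; apply/eqP.
  rewrite eq_sym subr_eq -PoszD [(_ + q w)%N]addnC qE PoszD; apply/eqP.
  by congr (_ + _); rewrite -[RHS]natz natr_sum; apply: eq_bigr => e _; rewrite natz.
have YE j i e : o i != Some (src e) -> Y j i * lreal K e = 0.
  move=> oi; rewrite -Yo -mulrA; case: (o i) oi => [v|] /=; last by rewrite mul0r mulr0.
  move=> ve; rewrite lvert_real ifN ?mulr0 //.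
have EX i j e : o i != Some (src e) -> lghost K e * X i j = 0.
  move=> oi; rewrite -oX mulrA; case: (o i) oi => [v|] /=; last by rewrite mulr0 mul0r.
  move=> ve; rewrite ghost_lvert ifN ?mul0r //.
have [||||||q qE] := IH (edge E * I)%type (shift_label o)
  (fun p j => lghost K p.1 * X p.2 j) (fun j p => Y j p.2 * lreal K p.1).
- move=> [e i] [f k] /=.
  have -> : \sum_j lghost K e * X i j * (Y j k * lreal K f) =
            lghost K e * ediag K o i k * lreal K f.
    rewrite -XY mulr_sumr mulr_suml; apply: eq_bigr => j _.
    by rewrite !mulrA.
  rewrite /ediag /shift_label /= xpair_eqE andbC; case: (i == k) => /=; last first.
    by rewrite mulr0 mul0r.
  case: (o i) => [v|] /=; last by rewrite mulr0 mul0r if_same.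
  rewrite ghost_lvert; case: eqVneq => [->|ve].
    by rewrite eqxx lghost_lreal.
  rewrite mul0r; case: ifP => // _; case: eqP => // -[ev].
  by rewrite ev eqxx in ve.
- move=> j b; rewrite -YX.
  transitivity (\sum_e \sum_i (Y j i * lreal K e) * (lghost K e * X i b)).
    by rewrite pair_bigA.
  rewrite exchange_big; apply: eq_bigr => i _ /=.
  rewrite -[in RHS](mul1r (X i b)) -(sum_real_ghost K no_sink) mulr_suml mulr_sumr.
  by apply: eq_bigr => e _; rewrite !mulrA.
- move=> [e i] j; rewrite /shift_label /=; case: eqP => [_|/eqP oi] /=.
    by rewrite mulrA tgt_lghost.
  by rewrite mul0r EX.
- by move=> [e i] j; rewrite -mulrA Xo.
- move=> j [e i]; rewrite /shift_label /=; case: eqP => [_|/eqP oi] /=.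
    by rewrite -mulrA lreal_tgt.
  by rewrite mulr0 YE.
- by move=> [e i] j; apply: XN.
(* One round adds to the count of [o] a term of the required form, with the count itself as [q];
   this is subtracted again. *)
exists (fun v => q v - (count_label o v)%:Z) => w.
have := qE w; rewrite count_label_shift => qw.
rewrite sumrB.
have -> : (\sum_(e | w == tgt e) (count_label o (src e))%:Z) =
   (\sum_(e | w == tgt e) count_label o (src e))%N%:Z.
  by rewrite -[RHS]natz natr_sum; apply: eq_bigr => e _; rewrite natz.
rewrite qw; ring.
Qed.

End LatticeComparison.

(** * The Grothendieck group of a Leavitt path algebra *)

Section GrothendieckClasses.
Variable R : pzRingType.

Lemma iso_of_mx (e f : idem R) (x : 'M[R]_(idim e, idim f)) (y : 'M_(idim f, idim e)) :
  x *m y = e -> y *m x = f -> lmod_iso (im e) (im f).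
Proof.
move=> xy yx.
have xfye : x *m (f *m (y *m e)) = e.
  by rewrite -yx !mulmxA xy -(mulmxA e) xy !imx_idem.
have yexf : y *m (e *m (x *m f)) = f.
  by rewrite -xy !mulmxA yx -(mulmxA f) yx !imx_idem.
pose g (v : im e) := @imp R f (val v *m x); pose h (w : im f) := @imp R e (val w *m y).
have g_lin : linear g by move=> a u v; rewrite /g /= mulmxDl -scalemxAl linearP.
exists (HB.pack_for {linear im e -> im f} g (GRing.isLinear.Build R _ _ _ g g_lin)).
exists h => [v|w]; apply: val_inj; rewrite /= /h /g /= -!mulmxA.
  by rewrite xfye im_fix.
by rewrite yexf im_fix.
Qed.

Lemma mx_of_iso (e f : idem R) : lmod_iso (im e) (im f) ->
  exists (x : 'M[R]_(idim e, idim f)) (y : 'M_(idim f, idim e)),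
  [/\ x *m y = e, y *m x = f, e *m x = x, x *m f = x & y *m e = y].
Proof.
have mxE (e1 e2 : idem R) (g : {linear im e1 -> im e2}) :
    exists m : 'M[R]_(idim e1, idim e2), forall u, u *m m = val (g (@imp R e1 u)).
  pose k (u : 'rV_(idim e1)) := val (g (@imp R e1 u)).
  have k_lin : linear k by move=> a u v; rewrite /k !linearP.
  pose K := HB.pack_for {linear 'rV[R]_(idim e1) -> 'rV[R]_(idim e2)} k
    (GRing.isLinear.Build R _ _ _ k k_lin).
  by exists (lin1_mx K) => u; rewrite mul_rV_lin1.
move=> /[dup] /lmod_iso_sym _ [g [h gK hK]].
have h_lin : linear h := can2_linear gK hK.
pose H := HB.pack_for {linear im f -> im e} h (GRing.isLinear.Build R _ _ _ h h_lin).
have [x xE] := mxE e f g; have [y yE] := mxE f e H.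
have rowP m n (A B : 'M[R]_(m, n)) : (forall u : 'rV_m, u *m A = u *m B) -> A = B.
  by move=> AB; apply/row_matrixP => i; rewrite !rowE AB.
have impE (e1 : idem R) u : @imp R e1 (u *m e1) = @imp R e1 u.
  by apply: val_inj; rewrite /= -mulmxA imx_idem.
exists x, y; split; apply: rowP => u; rewrite ?mulmxA.
- by rewrite xE yE impK /= gK.
- by rewrite yE xE impK /= hK.
- by rewrite !xE impE.
- by rewrite xE im_fix.
- by rewrite yE im_fix.
Qed.

Definition K0cls (e : idem R) : K0 R := \pi_(groth (V R)) (\pi_(V R) e, 0).

Lemma V_addE (e f : idem R) :
  (\pi_(V R) e + \pi_(V R) f : V R) = \pi_(V R) (idem_add e f).
Proof. exact: vaddE. Qed.

Lemma groth_addE (M : nmodType) (x y : M * M) :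
  (\pi_(groth M) x + \pi_(groth M) y : groth M) = \pi_(groth M) (x.1 + y.1, x.2 + y.2).
Proof. exact: gaddE. Qed.

Lemma groth_oppE (M : nmodType) (x : M * M) :
  (- \pi_(groth M) x : groth M) = \pi_(groth M) (x.2, x.1).
Proof. exact: goppE. Qed.

Lemma K0cls_add e f : K0cls (idem_add e f) = K0cls e + K0cls f.
Proof. by rewrite [RHS]groth_addE /= V_addE addr0. Qed.

Lemma K0cls_diff (x : K0 R) : exists e f, x = K0cls e - K0cls f.
Proof.
elim/quotW: x => -[]; elim/quotW=> e; elim/quotW=> f; exists e, f.
by rewrite [X in _ + X]groth_oppE [RHS]groth_addE /= addr0 add0r.
Qed.

Lemma K0cls_iso e f : lmod_iso (im e) (im f) -> K0cls e = K0cls f.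
Proof. by move=> /V_eqP ef; rewrite /K0cls ef. Qed.

Lemma K0cls_eqP e f :
  K0cls e = K0cls f <-> exists k, lmod_iso (im (idem_add e k)) (im (idem_add f k)).
Proof.
rewrite /K0cls groth_eqP; split=> [[k]|[k ef]] /=; last first.
  by exists (\pi_(V R) k); rewrite /= !addr0 !V_addE; apply/V_eqP.
by elim/quotW: k => k; rewrite !addr0 !V_addE => /V_eqP; exists k.
Qed.

End GrothendieckClasses.

(** * Classes of vertices and their relations *)

Section GrothendieckGroup.
Variables (K : fieldType) (E : digraph).
Local Notation L := (leavitt K E).
Local Notation V := (vertex E).
Local Notation ov := (@overt K E).
Hypothesis no_sink : forall v : V, exists e : edge E, src e = v.

Definition diag_overt_mx k (o : 'I_k -> option V) : 'M[L]_k :=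
  \matrix_(i, j) ediag K o i j.

Fact diag_overt_idem k (o : 'I_k -> option V) :
  diag_overt_mx o *m diag_overt_mx o = diag_overt_mx o.
Proof.
apply/matrixP => i j; rewrite !mxE (bigD1 i) //= !mxE /ediag eqxx big1 ?addr0.
  by case: eqP; rewrite ?mulr0 // overtMid.
by move=> l /negPf li; rewrite !mxE /ediag eq_sym li mul0r.
Qed.
Definition diag_overt k (o : 'I_k -> option V) : idem L := Idem (diag_overt_idem o).

Lemma split_diag_iso (e : idem L) (I : finType) (o : I -> option V)
    (X : 'I_(idim e) -> I -> L) Y :
  (forall a b, \sum_i X a i * Y i b = e a b) ->
  (forall i k, \sum_a Y i a * X a k = ediag K o i k) ->
  lmod_iso (im e) (im (diag_overt (fun i : 'I_#|I| => o (enum_val i)))).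
Proof.
move=> XY YX.
apply: (@iso_of_mx _ e (diag_overt _) (\matrix_(a, i) X a (enum_val i))
   (\matrix_(i, b) Y (enum_val i) b)).
  apply/matrixP => a b; rewrite -XY !mxE (reindex (@enum_val I I)) /=; last first.
    by apply: onW_bij; apply: enum_val_bij.
  by apply: eq_bigr => i _; rewrite !mxE.
apply/matrixP => i k; rewrite !mxE.
under eq_bigr do rewrite !mxE.
by rewrite YX /ediag (inj_eq enum_val_inj).
Qed.

Lemma idem_diag_iso (e : idem L) : exists k (o : 'I_k -> option V),
  lmod_iso (im e) (im (diag_overt o)).
Proof.
have ee a b : \sum_c e a c * e c b = e a b.
  by rewrite -[in RHS](imx_idem e) mxE.
have [I [o [X [Y [XY YX]]]]] := idempotent_split no_sink ee.
by exists #|I|, (fun i => o (enum_val i)); apply: split_diag_iso XY YX.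
Qed.

(** The class of the projective module [L v], or of the zero module for [None]. *)
Definition vcls (o : option V) : K0 L := K0cls (diag_overt (fun _ : 'I_1 => o)).

Lemma idem_eq_iso n (A B : 'M[L]_n) A_idem B_idem : A = B ->
  lmod_iso (im (@Idem _ n A A_idem)) (im (@Idem _ n B B_idem)).
Proof.
move=> AB; subst B; have -> : A_idem = B_idem by apply: Prop_irrelevance.
exact: lmod_iso_refl.
Qed.

Lemma vclsN : vcls None = 0.
Proof.
transitivity (K0cls (idem0 L)); last by [].
apply: K0cls_iso; apply: (@iso_of_mx _ (diag_overt _) (idem0 L) 0 0).
  apply/matrixP => i j; rewrite !mxE /ediag big1 => [|[] //].
  by case: eqP.
by apply/matrixP => -[].
Qed.

Definition cat_ord k l (o : 'I_k -> option V) (o' : 'I_l -> option V) (i : 'I_(k + l)) :=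
  match split i with inl j => o j | inr j => o' j end.

Lemma diag_overt_cat k l (o : 'I_k -> option V) (o' : 'I_l -> option V) :
  lmod_iso (im (idem_add (diag_overt o) (diag_overt o'))) (im (diag_overt (cat_ord o o'))).
Proof.
apply: idem_eq_iso; apply/matrixP => i j; rewrite /= [RHS]mxE /ediag /cat_ord.
case: (split_ordP i) => i' ->; case: (split_ordP j) => j' ->;
  rewrite ?(block_mxEul, block_mxEur, block_mxEdl, block_mxEdr) mxE /ediag.
- by rewrite (inj_eq (@lshift_inj _ _)).
- by rewrite eq_lrshift.
- by rewrite eq_rlshift.
- by rewrite (inj_eq (@rshift_inj _ _)).
Qed.

Lemma K0cls_diag k (o : 'I_k -> option V) : K0cls (diag_overt o) = \sum_i vcls (o i).
Proof.
elim: k o => [|k IH] o.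
  rewrite big_ord0; transitivity (K0cls (idem0 L)); last by [].
  by apply/K0cls_iso/idem_eq_iso/matrixP => -[].
rewrite big_ord_recl -IH -K0cls_add.
apply/K0cls_iso/lmod_iso_sym/(lmod_iso_trans (diag_overt_cat _ _)).
apply: (@idem_eq_iso k.+1); congr diag_overt_mx; apply/funext => i.
rewrite /cat_ord; case: splitP => j ij; congr o; apply: val_inj; rewrite /= ij //.
by case: j {ij} => -[].
Qed.

Lemma K0cls_split (e : idem L) (I : finType) (o : I -> option V)
    (X : 'I_(idim e) -> I -> L) Y :
  (forall a b, \sum_i X a i * Y i b = e a b) ->
  (forall i k, \sum_a Y i a * X a k = ediag K o i k) ->
  K0cls e = \sum_i vcls (o i).
Proof.
move=> XY YX; rewrite (K0cls_iso (split_diag_iso XY YX)) K0cls_diag.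
by rewrite [RHS](reindex (@enum_val I I)) //; apply: onW_bij; apply: enum_val_bij.
Qed.

(** By CK1 and CK2 the row of edges leaving [v] and the column of their ghosts are mutually inverse,
    between [L v] and the sum of the [L (tgt e)]. *)
Lemma vcls_out v : vcls (Some v) = \sum_(e | src e == v) vcls (Some (tgt e)).
Proof.
rewrite [LHS](@K0cls_split (diag_overt (fun _ : 'I_1 => Some v)) (edge E)
  (fun e => if src e == v then Some (tgt e) else None)
  (fun _ e => if src e == v then lreal K e else 0)
  (fun e _ => if src e == v then lghost K e else 0)).
- by rewrite [RHS]big_mkcond; apply: eq_bigr => e _; case: eqP => // _; rewrite vclsN.
- move=> a b; rewrite !ord1 mxE /ediag eqxx /= -(lvert_sum K no_sink) [RHS]big_mkcond.
  by apply: eq_bigr => e _; case: eqP => // _; rewrite mul0r.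
- move=> e f; rewrite big_ord1 /ediag; case: (eqVneq (src e) v) => [ev|_]; last first.
    by rewrite mul0r if_same.
  case: (eqVneq e f) => [<-|ef]; first by rewrite ev eqxx lghost_lreal eqxx.
  by case: eqP => _; rewrite ?mulr0 // lghost_lreal (negPf ef).
Qed.

Lemma sum_vcls (I : finType) (o : I -> option V) :
  \sum_i vcls (o i) = \sum_v vcls (Some v) *+ count_label o v.
Proof.
rewrite (partition_big o xpredT) //= (bigD1 None) //= big1 ?add0r => [|i /eqP ->]; last first.
  exact: vclsN.
rewrite (reindex_omap Some id) /=; last by case.
apply: eq_big => [v|v _]; first by rewrite eqxx.
rewrite (eq_bigr (fun _ => vcls (Some v))) => [|i /eqP -> //].
by rewrite sumr_const.
Qed.

Lemma K0_spanned (x : K0 L) : exists z : V -> int, x = \sum_v vcls (Some v) *~ z v.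
Proof.
have [e [f ->]] := K0cls_diff x.
have [k [o eo]] := idem_diag_iso e; have [l [p fp]] := idem_diag_iso f.
exists (fun v => (count_label o v)%:Z - (count_label p v)%:Z).
rewrite (K0cls_iso eo) (K0cls_iso fp) !K0cls_diag !sum_vcls -sumrB.
by apply: eq_bigr => v _; rewrite mulrzBr.
Qed.

Lemma diag_iso_count k l (o : 'I_k -> option V) (p : 'I_l -> option V) :
  lmod_iso (im (diag_overt o)) (im (diag_overt p)) ->
  exists q : V -> int, forall w,
    (count_label o w)%:Z = (count_label p w)%:Z + \sum_(e | w == tgt e) q (src e) - q w.
Proof.
move=> /mx_of_iso[x [y [xy yx ex xf ye]]].
have [N xN] : exists N, forall i j, tame N (x i j).
  have /choice[N xN] (a : 'I_k * 'I_l) := tame_ex (x a.1 a.2).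
  exists (\max_a N a) => i j.
  by apply: tame_le (xN (i, j)); apply: (leq_bigmax (i, j)).
have diagl m n (r : 'I_m -> option V) (A : 'M[L]_(m, n)) i j :
    (diag_overt r *m A) i j = ov (r i) * A i j.
  rewrite mxE (bigD1 i) //= mxE /ediag eqxx big1 ?addr0 // => a /negPf ai.
  by rewrite mxE /ediag eq_sym ai mul0r.
have diagr m n (r : 'I_n -> option V) (A : 'M[L]_(m, n)) i j :
    (A *m diag_overt r) i j = A i j * ov (r j).
  rewrite mxE (bigD1 j) //= mxE /ediag eqxx big1 ?addr0 // => a /negPf aj.
  by rewrite mxE /ediag aj mulr0.
apply: (@count_equivalent K E no_sink _ p N _ o (fun i j => x i j) (fun j i => y j i)).
- by move=> i j; move/matrixP/(_ i j): xy; rewrite !mxE.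
- by move=> i j; move/matrixP/(_ i j): yx; rewrite !mxE.
- by move=> i j; rewrite -[in LHS]diagl ex.
- by move=> i j; rewrite -[in LHS]diagr xf.
- by move=> i j; rewrite -[in LHS]diagr ye.
- exact: xN.
Qed.

Lemma count_labelE (N : finType) (l : N -> option V) w :
  count_label l w = (\sum_i (l i == Some w))%N.
Proof.
by rewrite /count_label -sum1_card big_mkcond; apply: eq_bigr => i _; rewrite inE; case: eqP.
Qed.

Lemma count_cat_ord k l (o : 'I_k -> option V) (p : 'I_l -> option V) w :
  count_label (cat_ord o p) w = (count_label o w + count_label p w)%N.
Proof.
rewrite !count_labelE big_split_ord; congr (_ + _)%N; apply: eq_bigr => i _.
  by rewrite /cat_ord (unsplitK (inl i)).
by rewrite /cat_ord (unsplitK (inr i)).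
Qed.

Lemma exists_count (z : V -> nat) : exists k (o : 'I_k -> option V), count_label o =1 z.
Proof.
pose I : finType := (V * 'I_(\max_v z v))%type.
pose p (x : I) := if (x.2 < z x.1)%N then Some x.1 else None.
exists #|I|, (fun i => p (enum_val i)) => w.
transitivity (\sum_(x : I) (p x == Some w))%N.
  rewrite count_labelE [RHS](reindex (@enum_val I I)) //.
  by apply: onW_bij; apply: enum_val_bij.
transitivity (\sum_v \sum_(i < \max_v z v) (p (v, i) == Some w))%N.
  by rewrite pair_bigA; apply: eq_bigr => -[].
rewrite (bigD1 w) //= [X in (_ + X)%N]big1 ?addn0 => [|v vw]; last first.
  apply: big1 => i _; rewrite /p /=; case: ifP => // _.
  by apply/eqP; rewrite eqb0; apply: contra vw => /eqP[->].
transitivity (\sum_(i < \max_v z v | (i < z w)%N) 1)%N.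
  by rewrite [RHS]big_mkcond; apply: eq_bigr => i _; rewrite /p /=; case: ifP; rewrite ?eqxx.
by rewrite -(big_ord_widen _ (fun _ => 1%N)) ?leq_bigmax // sum_nat_const card_ord muln1.
Qed.

(** The positive and negative parts of [z] are counts of two stably isomorphic diagonal idempotents.
    The added summand can be made diagonal too, and its count cancels. *)
Lemma K0_relations (z : V -> int) : \sum_v vcls (Some v) *~ z v = 0 ->
  exists q : V -> int, forall w, z w = \sum_(e | w == tgt e) q (src e) - q w.
Proof.
pose zp v := if z v is Posz m then m else 0%N.
pose zn v := if z v is Negz m then m.+1 else 0%N.
have zE v : z v = (zp v)%:Z - (zn v)%:Z.
  by rewrite /zp /zn; case: (z v) => m; rewrite ?subr0 // NegzE sub0r.
have [k [o oE]] := exists_count zp; have [l [p pE]] := exists_count zn.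
move=> z0; have : K0cls (diag_overt o) = K0cls (diag_overt p).
  apply/eqP; rewrite -subr_eq0 !K0cls_diag !sum_vcls -sumrB -[X in _ == X]z0.
  by apply/eqP/eq_bigr => v _; rewrite oE pE zE mulrzBr.
move=> /K0cls_eqP[e]; have [m [r er]] := idem_diag_iso e => iso_e.
have iso_cat a (s : 'I_a -> option V) :
    lmod_iso (im (idem_add (diag_overt s) e)) (im (diag_overt (cat_ord s r))).
  apply: lmod_iso_trans (im_add_iso (lmod_iso_refl _) er) _; exact: diag_overt_cat.
have [q qE] := diag_iso_count
  (lmod_iso_trans (lmod_iso_sym (iso_cat _ o)) (lmod_iso_trans iso_e (iso_cat _ p))).
exists q => w; have := qE w; rewrite !count_cat_ord oE pE zE !PoszD; lia.
Qed.

End GrothendieckGroup.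

(** * Fibonacci numbers and the determinant *)

Section Fibonacci.
Local Notation fz n := (fib n)%:Z.

Lemma fibSS n : fib n.+2 = (fib n.+1 + fib n)%N.
Proof. by []. Qed.

Lemma fzSS n : fz n.+2 = fz n.+1 + fz n.
Proof. by rewrite fibSS PoszD. Qed.

Lemma fib_gt0 n : (0 < fib n.+1)%N.
Proof. by elim: n => // n IH; rewrite fibSS addn_gt0 IH. Qed.

Lemma cassini n : fz n ^+ 2 + fz n * fz n.+1 - fz n.+1 ^+ 2 = (-1) ^+ n.+1.
Proof.
elim: n => // n IH; rewrite fzSS [RHS]exprS -IH; ring.
Qed.

(** The factor [fz k.+1 + 2 * fz k] is the Lucas number of index [k.+1]. *)
Lemma fib_double k :
  fz k.*2.+2 = fz k.+1 * (fz k.+1 + 2 * fz k) /\ fz k.*2.+1 = fz k.+1 ^+ 2 + fz k ^+ 2.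
Proof.
elim: k => // k [IH1 IH2]; rewrite doubleS.
rewrite [in X in X /\ _]fzSS [fz k.*2.+3]fzSS IH1 IH2 [fz k.+2]fzSS; split; ring.
Qed.

Lemma odd_fib n : odd (fib n) = ~~ (3 %| n)%N.
Proof.
suff : [/\ odd (fib n) = ~~ (3 %| n)%N, odd (fib n.+1) = ~~ (3 %| n.+1)%N
         & odd (fib n.+2) = ~~ (3 %| n.+2)%N] by case.
elim: n => // n [IH0 IH1 IH2]; split=> //.
rewrite (fibSS n.+1) oddD IH2 IH1.
have : (n %% 3 < 3)%N by rewrite ltn_mod.
by rewrite /dvdn -[n.+3]addn3 -[n.+2]addn2 -[n.+1]addn1 modnDr -[((n + 2) %% 3)%N]modnDml
  -[((n + 1) %% 3)%N]modnDml; case: (n %% 3)%N => [|[|[|]]].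
Qed.

Lemma d_dvd n : ((d n)%:Z %| fz n)%Z /\ ((d n)%:Z %| fz n.-1 - 1)%Z.
Proof.
by rewrite /d abszE ger0_norm ?dvdz_gcdl ?dvdz_gcdr // lez_nat.
Qed.

Lemma dvd_d n m : (m %| fz n)%Z -> (m %| fz n.-1 - 1)%Z -> (m %| (d n)%:Z)%Z.
Proof. by move=> mn mn1; rewrite dvdzE absz_nat /d -dvdzE dvdz_gcd mn. Qed.

Lemma d_gt0 n : (0 < n)%N -> (0 < d n)%N.
Proof.
case: n => // n _; rewrite /d absz_gt0 gcdz_eq0 negb_and.
by have := fib_gt0 n; lia.
Qed.

(** The relation matrix has rows [(a + b, a)] and [(a, b)], so this form is minus its determinant;
    Cassini's identity makes the value linear. *)
Lemma fib_norm n : (0 < n)%N ->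
  let a := fz n in let b := fz n.-1 - 1 in
  a ^+ 2 - a * b - b ^+ 2 = a + 2 * b + 1 - (-1) ^+ n.
Proof. by case: n => // n _ /=; have := cassini n => /= <-; ring. Qed.

Lemma fib_gt1 m : (2 < m)%N -> (1 < fib m)%N.
Proof.
case: m => [|[|[|m]]] // _; rewrite !fibSS.
by have := fib_gt0 m; have := fib_gt0 m.+1; rewrite fibSS; lia.
Qed.

Lemma fib_norm_neq0 n : (0 < n)%N ->
  let a := fz n in let b := fz n.-1 - 1 in a ^+ 2 - a * b - b ^+ 2 != 0.
Proof.
move=> n0 /=; rewrite fib_norm //.
have sgn : (-1) ^+ n = 1 :> int \/ (-1) ^+ n = -1 :> int.
  by rewrite -signr_odd; case: (odd n); [right | left].
case: n n0 sgn => [|[|[|n]]] // _ sgn.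
have := @fib_gt1 n.+3 isT; have := fib_gt0 n.+1; rewrite [n.+3.-1]/= => f2 f3.
by case: sgn => ->; lia.
Qed.

(** For odd [n], [fib_norm] forces [d n] to divide 2, and the parity of [fib n] decides. For even
    [n], the Fibonacci or the Lucas number of index [n/2] divides both arguments of the gcd. *)
Lemma d_eq1 n : (0 < n)%N ->
  d n = 1%N <-> [\/ n = 2%N, n = 4%N, (n = 1 %[mod 6])%N | (n = 5 %[mod 6])%N].
Proof.
move=> n0; have [dn dn1] := d_dvd n; split=> [d1|].
  have nodiv (m : int) : (m %| fz n)%Z -> (m %| fz n.-1 - 1)%Z -> `|m|%N = 1%N.
    by move=> mn mn1; have := dvd_d mn mn1; rewrite d1 dvdzE dvdn1 => /eqP.
  case: (boolP (odd n)) => on.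
    have n3 : ~~ (3 %| n)%N.
      apply/negP => n3; have := nodiv 2; rewrite !dvdzE /= !dvdn2 odd_fib n3 => /(_ isT).
      have on1 : odd (fib n.-1).
        by rewrite odd_fib; move: n3 n0 {nodiv}; case: n {dn dn1 d1 on} => // k; lia.
      have := fib_gt0 n.-2 => f0 H.
      suff : odd `|fz n.-1 - 1| = false by move/negbT => /H.
      by case: (fib n.-1) on1 => // k; rewrite intS addrAC subrr add0r => /negbTE.
    have : (n %% 6 == 1)%N || (n %% 6 == 5)%N by lia.
    by case/orP => /eqP ->; [constructor 3 | constructor 4].
  have nE : n = (n./2)%N.*2 by rewrite even_halfK.
  case: (ltnP 2 n./2) => m3; last first.
    have : n = 2%N \/ n = 4%N by lia.
    by case=> ->; [constructor 1 | constructor 2].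
  (* The sign in Cassini's identity, given by the parity of [k], decides which factor from
     [fib_double] also divides [fz n.-1 - 1]. *)
  exfalso; move: nE nodiv m3; case: (n./2) => // k -> nodiv k2.
  have [f2 f1] := fib_double k; have := cassini k.
  rewrite doubleS /= in nodiv; rewrite f2 f1 in nodiv.
  rewrite -signr_odd oddS; case: (odd k); rewrite ?expr0 ?expr1 => cas.
    suff : `|fz k.+1|%N = 1%N by have := fib_gt1 k2; lia.
    apply: nodiv; first exact: dvdz_mulr.
    have -> : fz k.+1 ^+ 2 + fz k ^+ 2 - 1 = fz k.+1 * (2 * fz k.+1 - fz k).
      by rewrite -[X in _ - X]cas; ring.
    exact: dvdz_mulr.
  suff : `|(fz k.+1 + 2 * fz k)%R|%N = 1%N by have := fib_gt1 k2; lia.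
  apply: nodiv; first exact: dvdz_mull.
  have -> : fz k.+1 ^+ 2 + fz k ^+ 2 - 1 = fz k * (fz k.+1 + 2 * fz k).
    rewrite -[X in _ + X]cas; ring.
  exact: dvdz_mull.
have odd_case : odd n -> ~~ (3 %| n)%N -> d n = 1%N.
  move=> on n3; have d2 : ((d n)%:Z %| 2)%Z.
    have : ((d n)%:Z %| (fz n) ^+ 2 - fz n * (fz n.-1 - 1) - (fz n.-1 - 1) ^+ 2)%Z.
      by rewrite !rpredB // ?dvdz_exp // dvdz_mulr.
    rewrite fib_norm // -signr_odd on expr1 opprK => dv.
    have -> : 2 = fz n + 2 * (fz n.-1 - 1) + 1 + 1 - (fz n + 2 * (fz n.-1 - 1)) :> int by ring.
    by rewrite rpredB // rpredD // dvdz_mull.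
  have := dvdn_leq (isT : 0 < 2)%N; rewrite dvdzE /= in d2 => /(_ _ d2).
  case: (d n) (d_gt0 n0) dn d2 => [|[|[|]]] // _; rewrite dvdzE /= dvdn2 odd_fib n3 //.
by case=> [->|->|n1|n5] //; apply: odd_case; lia.
Qed.

End Fibonacci.

(** * Determinants of cycle matrices *)

Section Circulant.
Variables (R : comNzRingType).

Definition cycle_mx n : 'M[R]_n := \matrix_(i, k) (k == ordS i)%:R.

(** In the first column only the corner and the wrap-around entry are nonzero, and both minors are
    triangular. *)
Lemma det_cycle_mx n (x : R) : (0 < n)%N -> \det (1%:M - x *: cycle_mx n) = 1 - x ^+ n.
Proof.
case: n => [//|[|m]] _.
  by rewrite det_mx11 !mxE ord1 eqxx mulr1 expr1.
set M := _ - _.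
have ordSE (i : 'I_m.+2) : ordS i = (if i == m.+1 :> nat then 0 else i.+1)%N :> nat.
  rewrite /=; case: eqP => [->|im]; first by rewrite modnn.
  by rewrite modn_small //; have := ltn_ord i; lia.
have ME i k : M i k = ((i : nat) == k)%:R -
    x * ((k : nat) == if (i : nat) == m.+1 then 0%N else i.+1)%:R.
  by rewrite !mxE -!val_eqE [val (ordS i)]ordSE.
rewrite (expand_det_col M ord0) (bigD1 ord0) //= (bigD1 ord_max) //= big1 ?addr0; last first.
  move=> i; rewrite -!val_eqE /= => /andP[/negbTE i0 /negbTE im].
  by rewrite ME i0 im mulr0 subr0 mul0r.
have minor0 : \det (row' ord0 (col' ord0 M)) = 1.
  rewrite -det_tr det_trig.
    apply: big1 => i _; rewrite mxE 2!mxE ME !lift0 eqxx.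
    suff -> : (i.+1 == if i.+1 == m.+1 then 0%N else i.+2) = false by rewrite mulr0 subr0.
    by case: ifP; lia.
  apply/is_trig_mxP => i j ij; rewrite mxE 2!mxE ME !lift0.
  have -> : (i.+1 == if j.+1 == m.+1 then 0%N else j.+2) = false by case: ifP; lia.
  have -> : (j.+1 == i.+1) = false by lia.
  by rewrite mulr0 subr0.
have minor_max : \det (row' ord_max (col' ord0 M)) = (- x) ^+ m.+1.
  rewrite det_trig.
    transitivity (\prod_(i < m.+1) (- x)); last by rewrite prodr_const card_ord.
    apply: eq_bigr => i _.
    have := ltn_ord i; rewrite 2!mxE ME lift0 lift_max => im.
    have -> : (i.+1 == if (i : nat) == m.+1 then 0%N else i.+1) by case: ifP; lia.
    have -> : ((i : nat) == i.+1) = false by lia.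
  by rewrite mulr1 sub0r.
  apply/is_trig_mxP => i j ij; have := ltn_ord i; rewrite 2!mxE ME lift0 lift_max => im.
  have -> : (j.+1 == if (i : nat) == m.+1 then 0%N else i.+1) = false by case: ifP; lia.
  have -> : ((i : nat) == j.+1) = false by lia.
  by rewrite mulr0 subr0.
rewrite /cofactor minor0 minor_max !ME /= eqxx !mulr0 subr0 !mul1r !mulr1 addn0 sub0r.
have sgn : (-1) ^+ m.+1 * (- x) ^+ m.+1 = x ^+ m.+1 by rewrite -exprMn mulN1r opprK.
by rewrite sgn mulNr -exprS.
Qed.

End Circulant.

Lemma incidence_cycle n :
  incidence_C2 n = cycle_mx int n + cycle_mx int n *m cycle_mx int n.
Proof.
apply/matrixP => i k; rewrite !mxE (bigD1 (ordS i)) //= !mxE eqxx mul1r.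
rewrite big1 ?addr0 => [|j /negPf ji]; last by rewrite !mxE ji mul0r.
rewrite -sum1_card big_mkcond big_sumType /= PoszD; congr (_ + _).
  rewrite (bigD1 i) //= big1 ?addr0; last by move=> j /negPf ji; rewrite inE /= ji.
  by rewrite addn0 inE /= eqxx eq_sym; case: eqP.
rewrite (bigD1 i) //= big1 ?addr0; last by move=> j /negPf ji; rewrite inE /= ji.
by rewrite addn0 inE /= eqxx eq_sym; case: eqP.
Qed.

Lemma H2_fib n : (0 < n)%N ->
  H2 n = `|((fib n)%:Z + 2 * (fib n.-1)%:Z - 1 - (-1) ^+ n)%R|%N.
Proof.
(* The determinant is the negative of the Fibonacci expression. *)
move=> n0; rewrite /H2 -abszN; congr absz.
rewrite -[1%:M]trmx1 -linearB det_tr incidence_cycle.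
apply: (@intr_inj algC); rewrite rmorphN /= -(det_map_mx (intmul 1)).
pose s : algC := sqrtC 5; pose t : algC := (1 + s) / 2; pose t' : algC := (1 - s) / 2.
have s2 : s ^+ 2 = 5 by apply: sqrtCK.
have tD : t + t' = 1 by rewrite /t /t'; field.
have tM : t * t' = -1.
  have -> : t * t' = (1 - s ^+ 2) / 4 by rewrite /t /t'; field.
  by rewrite s2; field.
(* Powers of a root reduce to Fibonacci numbers, which turns [t ^+ n + t' ^+ n] into an integer
   expression. *)
have tX (u : algC) k : u ^+ 2 = u + 1 -> u ^+ k.+1 = (fib k.+1)%:R * u + (fib k)%:R.
  move=> u2; elim: k => [|k IH]; first by rewrite mul1r addr0.
  rewrite exprSr IH fibSS natrD.
  transitivity ((fib k.+1)%:R * u ^+ 2 + (fib k)%:R * u); first by ring.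
  by rewrite u2; ring.
have t2 : t ^+ 2 = t + 1.
  have -> : t ^+ 2 = t * (t + t') - t * t' by ring.
  by rewrite tD tM mulr1 opprK.
have t'2 : t' ^+ 2 = t' + 1.
  have -> : t' ^+ 2 = t' * (t + t') - t * t' by ring.
  by rewrite tD tM mulr1 opprK.
clearbody t t'; pose P := cycle_mx algC n.
have -> : map_mx (intmul 1) (1%:M - (cycle_mx int n + cycle_mx int n *m cycle_mx int n)) =
    (1%:M - t *: P) *m (1%:M - t' *: P).
  have PE : map_mx (intmul 1) (cycle_mx int n) = P :> 'M[algC]_n.
    by apply/matrixP => i k; rewrite !mxE; case: eqP.
  rewrite map_mxB map_mxD map_mxM /= PE map_mx1.
  rewrite mulmxBl mul1mx mulmxBr mulmx1 -!scalemxAl -!scalemxAr scalerA tM scaleN1r.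
  have P_split : P = t *: P + t' *: P by rewrite -scalerDl tD scale1r.
  rewrite [X in _ - (X + _)]P_split; move: (P *m P) => Q.
  by apply/matrixP => i k; rewrite !mxE; ring.
rewrite det_mulmx !det_cycle_mx //.
have -> : (1 - t ^+ n) * (1 - t' ^+ n) = 1 - (t ^+ n + t' ^+ n) + (t * t') ^+ n.
  by rewrite exprMn; ring.
rewrite tM; case: n n0 {P} => [//|k _]; rewrite (tX t k t2) (tX t' k t'2).
have -> : (fib k.+1)%:R * t + (fib k)%:R + ((fib k.+1)%:R * t' + (fib k)%:R) =
    (fib k.+1)%:R * (t + t') + 2 * (fib k)%:R :> algC by ring.
rewrite tD -[k.+1.-1]/k !mulrzBr mulrzDr intrM -!pmulrn -!(signr_odd _ k.+1).
by case: (odd k.+1); rewrite ?expr1 ?expr0 ?mulrNz -?pmulrn; ring.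
Qed.

(** * The graph C_n^2 *)

Section CyclicGroups.

Lemma zmod_iso_of_ker (A B C : zmodType) (f : {additive A -> B}) (g : {additive A -> C}) :
  (forall b, exists a, f a = b) -> (forall c, exists a, g a = c) ->
  (forall a, f a = 0 <-> g a = 0) -> zmod_iso B C.
Proof.
move=> /choice[s fs] /choice[t gt] ker.
have fg a a' : f a = f a' <-> g a = g a'.
  have := ker (a - a'); rewrite !raddfB => -[fg gf].
  by split=> [/eqP|/eqP]; rewrite -subr_eq0 => /eqP h; apply/eqP; rewrite -subr_eq0;
    apply/eqP; [apply: fg | apply: gf].
pose k b := g (s b).
have kE a : k (f a) = g a by apply/fg; rewrite fs.
have k_add : zmod_morphism k.
  by move=> b c; rewrite -[b]fs -[c]fs -raddfB !kE raddfB.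
exists (HB.pack_for {additive B -> C} k (GRing.isZmodMorphism.Build B C k k_add)).
exists (fun c => f (t c)) => [b|c] /=; last by rewrite kE.
by rewrite -[RHS]fs; apply/fg; rewrite gt.
Qed.

Definition zproj m (x : int) : Zmod m := (inZp 1 : 'I_m.-1.+1) *~ x.

Fact zproj_additive m : zmod_morphism (@zproj m).
Proof. by move=> x y; rewrite /zproj mulrzBr. Qed.
HB.instance Definition _ m :=
  GRing.isZmodMorphism.Build int (Zmod m) (@zproj m) (zproj_additive m).

Lemma zproj_nat m (k : nat) : zproj m k = inZp k :> 'I_m.-1.+1.
Proof. by rewrite /zproj -pmulrn Zp_mulrn; apply: val_inj; rewrite /= modnMml mul1n. Qed.

Lemma zproj_eq0 m x : (0 < m)%N -> (zproj m x = 0) <-> (m%:Z %| x)%Z.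
Proof.
move=> m0; rewrite dvdzE absz_nat.
have natP (k : nat) : zproj m k = 0 <-> (m %| k)%N.
  rewrite zproj_nat -[in X in _ <-> X](prednK m0); split=> [/(congr1 val)|mk].
    by move=> /= /eqP.
  exact/val_inj/eqP.
case: (intP x) => [|k|k]; first exact: natP.
- exact: natP.
- have [zd dz] := natP k.+1; rewrite abszN raddfN; split=> [/eqP|/dz/eqP z].
    by rewrite oppr_eq0 => /eqP/zd.
  by apply/eqP; rewrite oppr_eq0.
Qed.

Lemma zproj_surj m (c : Zmod m) : exists x, zproj m x = c.
Proof. by exists (val c)%:Z; rewrite zproj_nat; apply: valZpK. Qed.

Lemma cyclic_iso (A B : zmodType) : zmod_iso A B -> cyclic_zmod A <-> cyclic_zmod B.
Proof.
move=> [f [h hK fK]]; split=> -[g gP].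
  by exists (f g) => y; have [k yk] := gP (h y); exists k; rewrite -raddfMz -yk fK.
exists (h g) => x; have [k xk] := gP (f x); exists k; apply: (can_inj hK).
by rewrite raddfMz /= fK.
Qed.

(** If [g *~ k = (1, 0)] and [g *~ l = (0, 1)], then [(0, 1) *~ k = (1, 0) *~ l], so [a * b] divides
    [k]. Thus [a] divides [k], and 1 is 0 modulo [a]. *)
Lemma cyclic_pair a b : (0 < a)%N -> (0 < b)%N ->
  cyclic_zmod (Zmod a * Zmod (a * b))%type <-> a = 1%N.
Proof.
move=> a0 b0; split=> [[g gP]|->]; last first.
  exists (0, zproj _ 1) => -[x y]; have [k yk] := zproj_surj y; exists k.
  rewrite [RHS]surjective_pairing; congr pair; first by rewrite [x]ord1 [RHS]ord1.
  rewrite -yk; move: (k) => j.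
  have -> : (((0, zproj (1 * b) 1) : Zmod 1 * Zmod (1 * b)) *~ j).2 = zproj (1 * b) 1 *~ j.
    exact: (raddfMz snd).
  by rewrite -raddfMz intz.
have ab0 : (0 < a * b)%N by rewrite muln_gt0 a0.
have [k gk] := gP (zproj a 1, 0); have [l gl] := gP (0, zproj (a * b) 1).
have dvd_ak : (a%:Z %| k)%Z.
  have : zproj (a * b) 1 *~ k = 0.
    have /(congr1 snd) : ((0, zproj (a * b) 1) : Zmod a * Zmod (a * b)) *~ k =
      (zproj a 1, 0) *~ l by rewrite gl gk -!mulrzA mulrC.
    by rewrite !(raddfMz snd) /= mul0rz.
  rewrite -raddfMz intz => /(zproj_eq0 _ ab0); apply: dvdz_trans.
  by rewrite dvdzE /= dvdn_mulr.
have : zproj a 1 = 0.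
  have [x gx] := zproj_surj g.1.
  have /(congr1 fst) := gk; rewrite (raddfMz fst) /= -gx -raddfMz => ->.
  by apply/zproj_eq0 => //; rewrite mulrzz dvdz_mull.
by move/(zproj_eq0 _ a0); rewrite dvdzE dvdn1 => /eqP.
Qed.

(* In the basis (a, b), (-w, u) of Z^2 the lattice spanned by m (a + b, a) and
   m (a, b) becomes m Z x m (a^2 - ab - b^2) Z. *)
Lemma lattice_coords (a b u w m N x y : int) :
  a * u + b * w = 1 -> N = a ^+ 2 - a * b - b ^+ 2 ->
  (exists s t, x = m * (s * (a + b) + t * a) /\ y = m * (s * a + t * b)) <->
  (m %| u * x + w * y)%Z /\ (m * N %| a * y - b * x)%Z.
Proof.
move=> uw ->; split=> [[s [t [-> ->]]]|[/dvdzP[p px] /dvdzP[q qy]]].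
  split; first by apply/dvdzP; exists (u * (s * (a + b) + t * a) + w * (s * a + t * b)); ring.
  by apply/dvdzP; exists s; ring.
have xE : x = a * (u * x + w * y) - w * (a * y - b * x).
  by rewrite -[LHS]mulr1 -uw; ring.
have yE : y = b * (u * x + w * y) + u * (a * y - b * x).
  by rewrite -[LHS]mulr1 -uw; ring.
(* These solve the two coordinate equations: [a y - b x = m N s] gives [s], and then [u x + w y]
   gives [t]. *)
exists q, (p - q * (u * (a + b) + w * a)); split.
  rewrite xE px qy; apply/eqP; rewrite -subr_eq0; apply/eqP.
  transitivity (p * m * a - w * q * m * (a ^+ 2 - a * b - b ^+ 2) -
    m * (q * (a + b) * (a * u + b * w) + (p - q * (u * (a + b) + w * a)) * a)).
    by rewrite uw; ring.
  ring.
rewrite yE px qy; apply/eqP; rewrite -subr_eq0; apply/eqP.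
transitivity (b * (p * m) + u * (q * (m * (a ^+ 2 - a * b - b ^+ 2))) -
    m * (q * a * (a * u + b * w) + (p - q * (u * (a + b) + w * a)) * b)).
  by rewrite uw; ring.
ring.
Qed.

End CyclicGroups.

(** * Two generators and their relations *)

Section CayleyGraph.
Variables (K : fieldType) (n : nat) (n_gt0 : (0 < n)%N).
Local Notation fz k := (fib k)%:Z.
Local Notation G := (K0 (leavitt K (C2 n))).
Local Notation cls i := (@vcls K (C2 n) (Some i)).

Lemma C2_no_sink (v : vertex (C2 n)) : exists e : edge (C2 n), src e = v.
Proof. by exists (inl v). Qed.

Lemma cls_rec (i : 'I_n) : cls i = cls (ordS i) + cls (ordS (ordS i)).
Proof.
rewrite [LHS](vcls_out K C2_no_sink) big_sumType /=; congr (_ + _); exact: big_pred1_eq.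
Qed.

(* Walking backwards around the cycle turns the relations into the Fibonacci
   recurrence. *)
Definition back_vertex k : 'I_n := iter k (@ord_pred n) (Ordinal n_gt0).

Lemma val_back_vertex k : (k <= n)%N -> back_vertex k = ((n - k) %% n)%N :> nat.
Proof.
elim: k => [|k IH] kn; first by rewrite subn0 modnn.
rewrite /back_vertex iterS /= IH; last exact: ltnW.
case: k kn {IH} => [|k] kn.
  by rewrite subn0 modnn add0n subn1.
rewrite [((n - k.+1) %% n)%N]modn_small; last by lia.
have -> : ((n - k.+1 + n).-1 = n - k.+2 + n)%N by lia.
by rewrite modnDr.
Qed.

Lemma back_vertex_n k : back_vertex (k + n) = back_vertex k.
Proof.
rewrite /back_vertex iterD; congr iter; apply: val_inj.
by rewrite [LHS](@val_back_vertex n) // subnn mod0n.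
Qed.

Lemma back_vertex_sub (i : 'I_n) : back_vertex (n - i) = i.
Proof.
apply: ord_inj; rewrite val_back_vertex ?leq_subr // subKn ?modn_small //.
exact: ltnW.
Qed.

Lemma cls_back_fib k :
  cls (back_vertex k.+1) = cls (back_vertex 1) *+ fib k.+1 + cls (back_vertex 0) *+ fib k.
Proof.
have rec j : cls (back_vertex j.+2) = cls (back_vertex j.+1) + cls (back_vertex j).
  by rewrite [LHS]cls_rec /back_vertex !iterS !ord_predK.
elim/ltn_ind: k => -[|[|k]] IH; first by rewrite addr0.
  by rewrite rec.
by rewrite rec (IH k.+1) // (IH k) // addrACA -!mulrnDr.
Qed.

Definition gen_map (p : int * int) : G :=
  cls (back_vertex 1) *~ p.1 + cls (back_vertex 0) *~ p.2.

Fact gen_map_additive : zmod_morphism gen_map.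
Proof. by move=> p q; rewrite /gen_map !mulrzBr opprD addrACA. Qed.
HB.instance Definition _ :=
  GRing.isZmodMorphism.Build (int * int)%type G gen_map gen_map_additive.

Lemma gen_map_back k : gen_map (fz k.+1, fz k) = cls (back_vertex k.+1).
Proof. by rewrite cls_back_fib /gen_map /= -!pmulrn. Qed.

Lemma gen_map_surj (x : G) : exists p, gen_map p = x.
Proof.
have [z ->] := K0_spanned C2_no_sink x.
(* Vertex [i] is the predecessor of order [n - i], which is positive, so [gen_map_back] applies. *)
exists (\sum_(i < n) (fz (n - i), fz (n - i).-1) *~ z i); rewrite raddf_sum.
apply: eq_bigr => i _; rewrite raddfMz; congr (_ *~ _).
have ni : (n - i = (n - i).-1.+1)%N by have := ltn_ord i; lia.
by rewrite -[in RHS](back_vertex_sub i) {1 3}ni -gen_map_back.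
Qed.

(** Summation by parts: the recurrence for [c] cancels all but the boundary terms. *)
Lemma telescope_fib (Q c : nat -> int) m : (forall k, c k.+2 = c k.+1 + c k) ->
  \sum_(k < m) (Q k.+2 + Q k.+3 - Q k.+1) * c k.+1 =
  Q m.+1 * c m.+1 + Q m.+2 * c m - (Q 1 * c 1 + Q 2 * c 0).
Proof.
move=> c_rec; elim: m => [|m IH]; first by rewrite big_ord0 subrr.
by rewrite big_ord_recr IH /= c_rec; ring.
Qed.

(** The two generating relations say that a full turn around the cycle fixes both generators.
    Conversely, pairing a relation from [K0_relations] with Fibonacci sequences recovers [s] and
    [t]. *)
Lemma gen_map_eq0 x y : gen_map (x, y) = 0 <->
  exists s t, x = s * (fz n + (fz n.-1 - 1)) + t * fz n /\ y = s * fz n + t * (fz n.-1 - 1).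
Proof.
have n1 : n = n.-1.+1 by rewrite prednK.
have fn1 : fz n.+1 = fz n + fz n.-1 by rewrite n1 fzSS.
split=> [xy0|[s [t [-> ->]]]]; last first.
  have back_n k : gen_map (fz (k + n), fz (k + n).-1) = cls (back_vertex k).
    have kn : (k + n = (k + n).-1.+1)%N by lia.
    by rewrite -(back_vertex_n k) kn -gen_map_back.
  have -> : (s * (fz n + (fz n.-1 - 1)) + t * fz n, s * fz n + t * (fz n.-1 - 1)) =
    ((fz (1 + n), fz (1 + n).-1) - (1, 0)) *~ s +
    ((fz n, fz n.-1) - (0, 1)) *~ t :> (int * int)%type.
    have pair_lin (x1 x2 x1' x2' y1 y2 y1' y2' : int) :
        ((x1, x2) - (x1', x2')) *~ s + ((y1, y2) - (y1', y2')) *~ t =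
        ((x1 - x1') * s + (y1 - y1') * t, (x2 - x2') * s + (y2 - y2') * t).
      rewrite [LHS]surjective_pairing !(raddfD fst) !(raddfD snd) !(raddfMz fst).
      by rewrite !(raddfMz snd) /= !mulrzz.
    by rewrite pair_lin add1n fn1; congr pair; ring.
  have mapD p q : gen_map (p + q) = gen_map p + gen_map q by exact: raddfD.
  have mapB p q : gen_map (p - q) = gen_map p - gen_map q by exact: raddfB.
  have mapM p k : gen_map (p *~ k) = gen_map p *~ k by exact: raddfMz.
  rewrite mapD !mapM !mapB back_n -[(fz n, _)]/(fz (0 + n), fz (0 + n).-1) back_n.
  by rewrite /gen_map /= !mulr1z !mulr0z addr0 add0r !subrr !mul0rz addr0.
(* A sum of indicators remains correct for [n = 1], where the two vertices coincide. *)
pose z (v : 'I_n) := (if v == back_vertex 1 then x else 0) +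
  (if v == back_vertex 0 then y else 0).
have delta (W : zmodType) (w : 'I_n) (c : int) (F : 'I_n -> int -> W) :
    (forall i, F i 0 = 0) -> \sum_v F v (if v == w then c else 0) = F w c.
  move=> F0; rewrite (bigD1 w) //= eqxx big1 ?addr0 // => v /negPf ->; exact: F0.
have [|q qz] := @K0_relations K (C2 n) C2_no_sink z.
  rewrite -[RHS]xy0 /gen_map /=; under eq_bigr do rewrite mulrzDr.
  rewrite big_split /= (delta _ _ _ (fun v c => cls v *~ c)) => [|i]; last exact: mulr0z.
  by rewrite (delta _ _ _ (fun v c => cls v *~ c)) // => i; exact: mulr0z.
pose Q k := q (back_vertex k).
have {}qz k : z (back_vertex k) = Q k.+1 + Q k.+2 - Q k.
  rewrite qz big_sumType /=; congr (_ + _ - _).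
    rewrite (big_pred1 (ord_pred (back_vertex k))) // => i /=.
    by apply/eqP/eqP => ->; rewrite ?ordSK ?ord_predK.
  rewrite (big_pred1 (ord_pred (ord_pred (back_vertex k)))) // => i /=.
  by apply/eqP/eqP => ->; rewrite ?ordSK ?ord_predK.
(* Pairing [z] with [c] telescopes, and the periodicity of [Q] simplifies the boundary terms. The
   vertex [back_vertex 0] is met at index [n], hence [y * c n]. *)
have sumz (c : nat -> int) : (forall k, c k.+2 = c k.+1 + c k) ->
    x * c 1%N + y * c n = Q 1%N * c n.+1 + Q 2%N * c n - (Q 1%N * c 1%N + Q 2%N * c 0%N).
  move=> c_rec; transitivity (\sum_(v < n) z v * c (n - v)%N).
    under eq_bigr do rewrite mulrDl.
    rewrite big_split /= (delta _ _ _ (fun v e => e * c (n - v)%N)) => [|i]; last exact: mul0r.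
    rewrite (delta _ _ _ (fun v e => e * c (n - v)%N)) => [|i]; last exact: mul0r.
    rewrite -[ord_pred _]/(back_vertex 1) subn0 val_back_vertex // modn_small; last by lia.
    by rewrite subKn.
  rewrite (reindex_inj rev_ord_inj) /=.
  transitivity (\sum_(k < n) (Q k.+2 + Q k.+3 - Q k.+1) * c k.+1).
    apply: eq_bigr => k _; rewrite subKn // -qz; congr (z _ * _).
    apply: ord_inj; rewrite val_back_vertex //= modn_small //.
    by have := ltn_ord k; lia.
  rewrite telescope_fib //; congr (_ * _ + _ * _ - _); rewrite /Q.
    by rewrite -add1n back_vertex_n.
  by rewrite -add2n back_vertex_n.
(* The two basic solutions, with initial values 0, 1 and 1, 0, give one equation each. *)
have := sumz (fun k => fz k) fzSS.
have := sumz (fun k => if k is k'.+1 then fz k' else 1)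
  (fun k => if k is k'.+1 then fzSS k' else erefl).
have -> : (if n is k'.+1 then fz k' else 1) = fz n.-1 by rewrite n1.
rewrite fn1 !mulr1 !mulr0 !add0r !addr0 => ey ex.
(* The shift by [y] accounts for [y] entering at index [n] instead of 0. *)
exists (Q 1%N), (Q 2%N - y); split.
  transitivity (x + y * fz n - y * fz n); first by rewrite addrK.
  by rewrite ex; ring.
transitivity (y * fz n.-1 - y * (fz n.-1 - 1)); first by ring.
by rewrite ey; ring.
Qed.

(** [gen_map] and the coordinates of [lattice_coords] are surjections from Z^2 with the same kernel;
    here [m] is [d n], and [a], [b] are the coprime quotients of the gcd arguments. *)
Lemma K0_C2_iso : zmod_iso G (Zmod (d n) * Zmod (H2 n %/ d n))%type /\
  exists2 N, (0 < N)%N & (H2 n %/ d n = d n * N)%N.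
Proof.
have d0 := d_gt0 n_gt0; have [/dvdzP[a aE] /dvdzP[b bE]] := d_dvd n.
have d_neq0 : (d n)%:Z != 0 by rewrite lt0n in d0.
have [u [w uw]] : exists u w, u * fz n + w * (fz n.-1 - 1) = (d n)%:Z.
  have [u [w uw]] := Bezoutz (fz n) (fz n.-1 - 1); exists u, w.
  by rewrite uw /d abszE ger0_norm // lez_nat.
have {}uw : a * u + b * w = 1.
  apply: (mulIf d_neq0); rewrite mul1r -[RHS]uw aE bE; ring.
pose N := a ^+ 2 - a * b - b ^+ 2.
have normE : (d n)%:Z ^+ 2 * N =
    fz n ^+ 2 - fz n * (fz n.-1 - 1) - (fz n.-1 - 1) ^+ 2.
  by rewrite aE bE /N; ring.
have N0 : (0 < `|N|)%N.
  rewrite absz_gt0; apply: contraTneq (fib_norm_neq0 n_gt0) => N0.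
  by rewrite negbK -normE N0 mulr0.
have H2E : (H2 n %/ d n = d n * `|N|)%N.
  have -> : H2 n = (d n * (d n * `|N|))%N.
    rewrite (H2_fib n_gt0) mulnA -[(d n * d n)%N]/(`|(d n)%:Z ^+ 2|%N) -abszM normE fib_norm //.
    by congr absz; ring.
  by rewrite mulKn.
split; last by exists `|N|%N.
rewrite H2E.
pose coord (p : int * int) : Zmod (d n) * Zmod (d n * `|N|) :=
  (zproj _ (u * p.1 + w * p.2), zproj _ (a * p.2 - b * p.1)).
have coord_add : zmod_morphism coord.
  move=> p q; rewrite [RHS]surjective_pairing (raddfB fst) (raddfB snd) /coord /=.
  by congr pair; rewrite -[RHS](raddfB (@zproj _)); congr zproj; ring.
pose C := HB.pack_for {additive (int * int)%type -> (Zmod (d n) * Zmod (d n * `|N|))%type} coord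
  (GRing.isZmodMorphism.Build _ _ coord coord_add).
apply: (@zmod_iso_of_ker _ _ _ gen_map C) => [|[c c']|[x y]].
- exact: gen_map_surj.
- have [p <-] := zproj_surj c; have [q <-] := zproj_surj c'.
  (* The combination of the basis vectors [(a, b)] and [(-w, u)] with coefficients [p] and [q]. *)
  exists (a * p - w * q, b * p + u * q); rewrite /= /coord /=.
  congr pair; congr zproj.
    transitivity ((a * u + b * w) * p); [by ring | by rewrite uw mul1r].
  transitivity ((a * u + b * w) * q); [by ring | by rewrite uw mul1r].
have dN0 : (0 < d n * `|N|)%N by rewrite muln_gt0 d0.
have lat := @lattice_coords a b u w (d n)%:Z N x y uw erefl.
have kerE : (exists s t, x = s * (fz n + (fz n.-1 - 1)) + t * fz n /\
      y = s * fz n + t * (fz n.-1 - 1)) <->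
    exists s t, x = (d n)%:Z * (s * (a + b) + t * a) /\ y = (d n)%:Z * (s * a + t * b).
  by split=> -[s [t [xE yE]]]; exists s, t; rewrite xE yE aE bE; split; ring.
have coord0 : coord (x, y) = 0 <->
    (d n %| u * x + w * y)%Z /\ ((d n)%:Z * N %| a * y - b * x)%Z.
  rewrite -(zproj_eq0 _ d0) -[((d n)%:Z * N %| _)%Z]/(_ %| _)%N abszM absz_nat.
  rewrite -[(d n * `|N| %| _)%N]/(((d n * `|N|)%N%:Z %| a * y - b * x)%Z).
  by rewrite -(zproj_eq0 _ dN0); split=> [[-> ->]|[]] //; rewrite /coord /= => -> ->.
by rewrite gen_map_eq0 kerE lat -coord0.
Qed.


End CayleyGraph.

Local Close Scope quotient_scope.
Local Close Scope ring_scope.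

Theorem theorem4p13 (K : fieldType) (n : nat) (n_gt0 : (0 < n)%N) :
  zmod_iso (K0 (leavitt K (C2 n))) (Zmod (d n) * Zmod (H2 n %/ d n))%type /\
  (cyclic_zmod (K0 (leavitt K (C2 n))) <->
   [\/ n = 2%N, n = 4%N, n = 1%N %[mod 6] | n = 5%N %[mod 6]]).
Proof.
have [iso [N N0 HN]] := K0_C2_iso K n_gt0; split=> //.
(* The first modulus divides the second, so the product is cyclic exactly when [d n] is 1. *)
rewrite (cyclic_iso iso) HN (cyclic_pair (d_gt0 n_gt0) N0); exact: d_eq1.
Qed.
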